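(* Let $M$ be a real manifold of class $C^2$, $N\subset M$ a submanifold of class $C^2$, and $K$ a $C^1$ subbundle of $TM$ such that $K|_N\subset TN$. Then there exists a natural $K$-partial connection $\nabla$ on the normal bundle $T_NM$, defined as follows: if $x\in N$, $X\in K[x]$ and $\eta$ is a local ($C^1$) section of $T_NM$ over a neighborhood of $x$ in $N$, then $$\nabla_X\eta\;=\;[\tilde X,\tilde Y](x)\ \bmod\ T_xN,$$ where $\tilde X$ is any $C^1$ local section of $K$ near $x$ extending $X$ and $\tilde Y$ is any ($C^1$) lifting of $\eta$ to $TM$ in a neighborhood of $x$. (That is, the right-hand side does not depend on the choices of $\tilde X$ and $\tilde Y$, and it defines a $K$-partial connection.)
   Context: For a submanifold $N$ of $M$, the normal bundle of $N$ in $M$ is $T_NM=TM|_N/TN$. $K[x]$ denotes the fiber of $K$ at $x$. A lifting of a local section $\eta$ of $T_NM$ is a local vector field $\tilde Y$ on $M$ near $x$ such that for $y\in N$ near $x$ the class of $\tilde Y(y)$ modulo $T_yN$ is $\eta(y)$. $[\cdot,\cdot]$ is the Lie bracket of vector fields. A $K$-partial connection on a vector bundle $H\to N$ (where $K|_N\subset TN$) is a bilinear map assigning to a local section $X$ of $K|_N$ (or a vector of $K|_N$) and a local $C^1$ section $\eta$ of $H$ a covariant derivative $\nabla_X\eta$ in $H$, satisfying $\nabla_{\phi X}\eta=\phi\nabla_X\eta$ and $\nabla_X(\phi\eta)=\phi\nabla_X\eta+(X\phi)\eta$ for all real-valued $C^1$ functions $\phi$; thus it is a connection in which covariant derivatives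 are defined only in the directions of $K$. *)

(* Defs.v *)
From HB Require Import structures.
From mathcomp Require Import all_boot all_order all_algebra.
From mathcomp Require Import generic_quotient ring_quotient.
From mathcomp Require Import all_classical all_reals all_analysis.
Set Implicit Arguments.
Unset Strict Implicit.
Unset Printing Implicit Defensive.
Import Order.TTheory GRing.Theory Num.Theory.
Import numFieldNormedType.Exports.
Local Open Scope classical_set_scope.
Local Open Scope ring_scope.
Local Open Scope quotient_scope.

Section Differentiability.
Context {R : realType} {V W : normedModType R}.

(* Meant for an open set A. In finite dimension, the continuity of
   y |-> 'd f y v for each fixed v is the continuity of the differential. *)
Definition C1_on (A : set V) (f : V -> W) : Prop :=
  forall x, A x -> differentiable f x /\
    forall v, {for x, continuous (fun y => 'd f y v)}.

Definition C2_on (A : set V) (f : V -> W) : Prop :=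
  C1_on A f /\ forall v, C1_on A (fun y => 'd f y v).

End Differentiability.

(* The quotient of a module by a submodule: the library provides only its
   additive group structure. *)
Section LmodQuotient.
Context {R : pzRingType} {V : lmodType R} (S : submodClosed V).

Definition submod_pred : {pred V} := S.

Fact submod_pred_zmod_closed : zmod_closed submod_pred.
Proof. exact: GRing.submod_closedB (submodClosedP S). Qed.
HB.instance Definition _ :=
  GRing.isZmodClosed.Build V submod_pred submod_pred_zmod_closed.

Definition lquot : Type := @Quotient.quot V submod_pred.
HB.instance Definition _ := GRing.Zmodule.on lquot.
HB.instance Definition _ := Quotient.on lquot.

Fact pi_lquot_eq (v w : V) : (\pi_lquot v == \pi_lquot w) = (v - w \in S).
Proof. exact/esym/(Quotient.idealrBE submod_pred). Qed.

Definition lscale (a : R) (u : lquot) : lquot := \pi_lquot (a *: repr u).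

Fact pi_lquotD (v w : V) : \pi_lquot (v + w) = \pi_lquot v + \pi_lquot w.
Proof. by rewrite /lquot raddfD. Qed.

Fact pi_lscale a v : \pi_lquot (a *: v) = lscale a (\pi_lquot v).
Proof.
apply/eqP; rewrite pi_lquot_eq -scalerBr.
by apply: rpredZ; rewrite -pi_lquot_eq reprK.
Qed.

Let lscaleA a b u : lscale a (lscale b u) = lscale (a * b) u.
Proof. by elim/quotW: u => v; rewrite -(pi_lscale b) -!pi_lscale scalerA. Qed.
Let lscale1 : left_id 1 lscale.
Proof. by elim/quotW => v; rewrite -pi_lscale scale1r. Qed.
Let lscaleDr : right_distributive lscale +%R.
Proof.
move=> a; elim/quotW => v; elim/quotW => w.
by rewrite -pi_lquotD -!pi_lscale -pi_lquotD scalerDr.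
Qed.
Let lscaleDl u : {morph lscale^~ u : a b / a + b}.
Proof.
by elim/quotW: u => v a b; rewrite -!pi_lscale -pi_lquotD scalerDl.
Qed.

HB.instance Definition _ := GRing.Zmodule_isLmodule.Build R lquot
  lscaleA lscale1 lscaleDr lscaleDl.

End LmodQuotient.

(* The functions cmap and cinv are total; only their restrictions to cdom and
   to cmap @` cdom matter. *)
Record chart (R : realType) (T : topologicalType) (n : nat) := Chart {
  cdom : set T;
  cmap : T -> 'rV[R]_n;
  cinv : 'rV[R]_n -> T;
  cdom_open : open cdom;
  cran_open : open (cmap @` cdom);
  cmapK : forall x, cdom x -> cinv (cmap x) = x;
  cmap_cont : forall x, cdom x -> {for x, continuous cmap};
  cinv_cont : forall x, cdom x -> {for cmap x, continuous cinv} }.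

Definition C2_transition (R : realType) (T : topologicalType) (n : nat)
    (c d : chart R T n) : Prop :=
  C2_on (cmap c @` (cdom c `&` cdom d)) (cmap d \o cinv c).

Record C2manifold (R : realType) (n : nat) := C2Manifold {
  mspace :> topologicalType;
  mspace_hausdorff : hausdorff_space mspace;
  mspace_countable : @second_countable mspace;
  atlas : set (chart R mspace n);
  atlas_cover : forall x, exists2 c, atlas c & cdom c x;
  atlas_C2 : forall c d, atlas c -> atlas d -> C2_transition c d;
  atlas_maximal : forall d,
    (forall c, atlas c -> C2_transition c d /\ C2_transition d c) -> atlas d }.

Section Tangent.
Context {R : realType} {n : nat} (M : C2manifold R n) (x : M).

(* A tangent vector at x is the family of its components in the charts of M
   around x, related by the differentials of the transition maps. *)
Definition tangent_family (v : chart R M n -> 'rV[R]_n) : Prop :=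
  (forall c d, atlas c -> atlas d -> cdom c x -> cdom d x ->
     v d = 'd (cmap d \o cinv c) (cmap c x) (v c)) /\
  (forall c, ~ (atlas c /\ cdom c x) -> v c = 0).

Definition tangent_pred : {pred (chart R M n -> 'rV[R]_n)} :=
  fun v => `[< tangent_family v >].

Fact tangent_submod_closed : submod_closed tangent_pred.
Proof.
split=> [|a u v /asboolP[u1 u2] /asboolP[v1 v2]].
  by apply/asboolP; split=> *; rewrite ?linear0.
apply/asboolP; split=> [c d hc hd cx dx|c hc].
  by rewrite !fctE (u1 c d) // (v1 c d) // linearP.
by rewrite !fctE u2 // v2 // scaler0 addr0.
Qed.
HB.instance Definition _ := GRing.isSubmodClosed.Build R
  (chart R M n -> 'rV[R]_n) tangent_pred tangent_submod_closed.

Record tangent := Tangent {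
  tcomp :> chart R M n -> 'rV[R]_n;
  tcompP : tcomp \in tangent_pred }.
HB.instance Definition _ := [isSub for tcomp].
HB.instance Definition _ := [Choice of tangent by <:].
HB.instance Definition _ := [SubChoice_isSubLmodule of tangent by <:].

Fact tcomp_linear c : linear (fun v : tangent => v c).
Proof. by move=> a u v; have /(congr1 (@^~ c)) := linearP (val : tangent -> _) a u v. Qed.

End Tangent.

Section VectorFields.
Context {R : realType} {n : nat} (M : C2manifold R n).

Definition C1_field_on (U : set M) (X : forall y, tangent y) : Prop :=
  forall c, atlas c ->
    C1_on (cmap c @` (cdom c `&` U)) (fun z => X (cinv c z) c).

Definition C1_field_near (x : M) (X : forall y, tangent y) : Prop :=
  exists2 U, open_nbhs x U & C1_field_on U X.

Definition is_lie_bracket (X Y : forall y, tangent y) (x : M)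
    (Z : tangent x) : Prop :=
  forall c, atlas c -> cdom c x ->
    Z c = 'd (fun z => Y (cinv c z) c) (cmap c x) (X x c)
        - 'd (fun z => X (cinv c z) c) (cmap c x) (Y x c).

Definition C1_subbundle (r : nat) (K : forall y : M, set (tangent y)) : Prop :=
  forall x : M, exists U, exists F : 'I_r -> forall y : M, tangent y,
    [/\ open_nbhs x U,
        forall i, C1_field_on U (F i) &
        forall y, U y ->
          (forall a : 'I_r -> R,
             \sum_(i < r) a i *: F i y = 0 -> forall i, a i = 0) /\
          K y = [set \sum_(i < r) a i *: F i y | a in [set: 'I_r -> R]]].

(* A C^1 local section of K near x whose value at x is v. *)
Definition section_extending (K : forall y : M, set (tangent y)) (x : M)
    (v : tangent x) (X : forall y, tangent y) : Prop :=
  [/\ C1_field_near x X, \forall y \near x, K y (X y) & X x = v].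

End VectorFields.

(* Submanifolds of dimension p and codimension q. *)
Section Submanifold.
Context {R : realType} {p q : nat} (M : C2manifold R (p + q)) (N : set M).

Definition slice_chart (c : chart R M (p + q)) : Prop :=
  atlas c /\ forall y, cdom c y -> (N y <-> rsubmx (cmap c y) = 0).

Definition C2_submanifold : Prop :=
  forall x, N x -> exists2 c, slice_chart c & cdom c x.

(* For x in the submanifold N, this is T_xN. The condition does not depend on
   the slice chart, because transition maps between slice charts preserve N. *)
Definition tangentN_pred (x : M) : {pred tangent x} :=
  fun v => `[< forall c, slice_chart c -> cdom c x -> rsubmx (v c) = 0 >].
Arguments tangentN_pred : clear implicits.

Fact tangentN_submod_closed x : submod_closed (tangentN_pred x).
Proof.
split=> [|a u v /asboolP hu /asboolP hv].
  by apply/asboolP => c hc cx; rewrite linear0.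
by apply/asboolP => c hc cx; rewrite tcomp_linear linearP /= hu // hv // scaler0 addr0.
Qed.
HB.instance Definition _ x := GRing.isSubmodClosed.Build R (tangent x)
  (tangentN_pred x) (@tangentN_submod_closed x).

Definition normal (x : M) : lmodType R := lquot (tangentN_pred x).

Definition normal_class (x : M) (v : tangent x) : normal x :=
  \pi_(lquot (tangentN_pred x)) v.

(* A slice chart c gives the chart u |-> cinv c (row_mx u 0) of N and, through
   the last q components, a trivialization of the normal bundle. *)
Definition slice_dom (c : chart R M (p + q)) (U : set M) : set 'rV[R]_p :=
  [set u | (cmap c @` (cdom c `&` U)) (row_mx u 0)].

Definition slice_pt (c : chart R M (p + q)) (u : 'rV[R]_p) : M :=
  cinv c (row_mx u 0).

Definition normal_comp (c : chart R M (p + q)) (x : M) (e : normal x)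
    : 'rV[R]_q :=
  rsubmx (repr (e : lquot (tangentN_pred x)) c).

(* Sections over N, and functions on N, are given as total functions on M; their
   values outside N are irrelevant. *)
Definition C1_normal_near (x : M) (eta : forall y, normal y) : Prop :=
  exists2 U, open_nbhs x U & forall c, slice_chart c ->
    C1_on (slice_dom c U) (fun u => normal_comp c (eta (slice_pt c u))).

Definition C1_fun_near (x : M) (phi : M -> R) : Prop :=
  exists2 U, open_nbhs x U & forall c, slice_chart c ->
    C1_on (slice_dom c U) (fun u => phi (slice_pt c u) : R^o).

(* The derivative of phi along v in T_xN, computed in the slice chart c. *)
Definition dir_derivative (c : chart R M (p + q)) (x : M) (v : tangent x)
    (phi : M -> R) : R :=
  'd (fun u => phi (slice_pt c u) : R^o) (lsubmx (cmap c x)) (lsubmx (v c)).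

Definition lifting_near (x : M) (eta : forall y, normal y)
    (Y : forall y, tangent y) : Prop :=
  C1_field_near x Y /\
  \forall y \near x, N y -> normal_class (Y y) = eta y.

(* nabla x v eta is the covariant derivative of eta at x in the direction of v
   in K[x]; it is a function of the germ of eta at x. In nabla_leibniz any slice
   chart may be used to compute the derivative of phi along v. *)
Record partial_connection (K : forall y : M, set (tangent y))
  (nabla : forall x : M, tangent x -> (forall y, normal y) -> normal x)
    : Prop := PartialConnection {
  nabla_local : forall x v eta eta', N x -> K x v ->
    C1_normal_near x eta -> C1_normal_near x eta' ->
    (\forall y \near x, N y -> eta y = eta' y) ->
    nabla x v eta = nabla x v eta';
  nabla_linear_dir : forall x a v w eta, N x -> K x v -> K x w ->
    C1_normal_near x eta ->
    nabla x (a *: v + w) eta = a *: nabla x v eta + nabla x w eta;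
  nabla_linear_section : forall x v a eta eta', N x -> K x v ->
    C1_normal_near x eta -> C1_normal_near x eta' ->
    nabla x v (fun y => a *: eta y + eta' y) =
    a *: nabla x v eta + nabla x v eta';
  nabla_leibniz : forall x v phi eta, N x -> K x v ->
    C1_fun_near x phi -> C1_normal_near x eta ->
    forall c, slice_chart c -> cdom c x ->
    nabla x v (fun y => phi y *: eta y) =
    phi x *: nabla x v eta + dir_derivative c v phi *: eta x }.

End Submanifold.

Arguments tangentN_pred {R p q M} N x _.

(* Main.v *)
Require Import Defs.
From HB Require Import structures.
From mathcomp Require Import all_boot all_order all_algebra.
From mathcomp Require Import all_classical all_reals all_analysis.
From mathcomp Require Import ring lra.
Set Implicit Arguments.
Unset Strict Implicit.
Unset Printing Implicit Defensive.
Import Order.TTheory GRing.Theory Num.Theory.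
Import numFieldNormedType.Exports.
Local Open Scope classical_set_scope.
Local Open Scope ring_scope.

(* Read in a slice chart c at x, the class of [X, Y](x) modulo T_xN is the
   transverse part of dY(X x) - dX(Y x).
   - Two liftings Y, Y' of eta differ by a field that is tangent to N along N;
     both X and this difference are tangent to N at x, and the derivative along
     N of a function vanishing on N is zero.
   - Two sections X, X' of K with the same value at x differ by
     D = sum_i a_i F_i, where F is a local C^1 frame of K and the coefficients
     a_i tend to 0 at x (no differentiability of the a_i is needed): since
     the transverse part of each F_i vanishes at x, that of the derivative of D
     at x vanishes too.
   The bracket does not depend on the chart by the symmetry of the second
   derivative of the C^2 transition maps. *)

(** * Functions of class C^1 and C^2 *)

Section NearDiff.
Context {R : realType} {V W : normedModType R}.
Implicit Types f g : V -> W.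

(** The first-order remainders of [f] and [g] at [x] agree near 0, so [g] satisfies the expansion of
    [f], and uniqueness of the differential concludes. Chart readings can be compared only locally,
    because [cinv] is arbitrary off the range of the chart. *)
Lemma near_is_diff f g x : {near x, f =1 g} -> differentiable f x ->
  differentiable g x /\ 'd g x = 'd f x :> (V -> W).
Proof.
move=> fg df.
have dg : g \o shift x = cst (g x) + 'd f x +o_ 0 id.
  apply/eqaddoP => e e0.
  have /diff_locally/eqaddoP/(_ e e0) H := df.
  have fg0 : \forall h \near 0, f (h + x) = g (h + x).
    by move: fg; rewrite (near_shift 0) /= subr0.
  near=> h.
  have <- : (f \o shift x - (cst (f x) + 'd f x)) h =
            (g \o shift x - (cst (g x) + 'd f x)) h.
    rewrite !fctE /= (nbhs_singleton fg).
    by congr (_ - _); near: h.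
  by near: h.
have E : 'd g x = 'd f x :> (V -> W).
  by apply: diff_unique => //; exact: diff_continuous.
by split=> //; apply/diff_locallyP; rewrite E; split=> //; exact: diff_continuous.
Unshelve. all: by end_near. Qed.

Lemma near_differentiable f g x : {near x, f =1 g} ->
  differentiable f x -> differentiable g x.
Proof. by move=> fg /(near_is_diff fg)[]. Qed.

Lemma near_diff f g x : {near x, f =1 g} -> differentiable f x ->
  'd g x = 'd f x :> (V -> W).
Proof. by move=> fg /(near_is_diff fg)[]. Qed.

Lemma C1_on_sub A B f : A `<=` B -> C1_on B f -> C1_on A f.
Proof. by move=> AB h x /AB; exact: h. Qed.

Lemma eq_C1_on A f g : open A -> (forall x, A x -> f x = g x) ->
  C1_on A f -> C1_on A g.
Proof.
move=> oA fg h x Ax; have [df cf] := h x Ax.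
have fgx y : A y -> {near y, f =1 g}.
  by move=> Ay; apply: filterS (open_nbhs_nbhs (conj oA Ay)); exact: fg.
split=> [|v]; first exact: near_differentiable (fgx x Ax) df.
have E y : A y -> 'd g y v = 'd f y v.
  by move=> Ay; have [dfy _] := h y Ay; rewrite (near_diff (fgx y Ay) dfy).
rewrite /prop_for /continuous_at E//.
apply: cvg_trans (cf v); apply: near_eq_cvg.
by apply: filterS (open_nbhs_nbhs (conj oA Ax)) => y /E /esym.
Qed.

(** Lets continuity be checked on an explicit formula [df]: it equals ['d f] on the whole open set
    [A], hence near each of its points. *)
Lemma C1_onI A f (df : V -> V -> W) : open A ->
  (forall x, A x -> is_diff x f (df x)) ->
  (forall v x, A x -> df y v @[y --> x] --> df x v) -> C1_on A f.
Proof.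
move=> oA dA cA x Ax; have dx := dA x Ax; split=> [|v]; first exact: ex_diff.
have E y : A y -> 'd f y v = df y v.
  by move=> /dA ?; rewrite diff_val.
rewrite /prop_for /continuous_at E//.
apply: cvg_trans (cA v x Ax); apply: near_eq_cvg.
by apply: filterS (open_nbhs_nbhs (conj oA Ax)) => y /E.
Qed.

Lemma C1_on_is_diff A f x : C1_on A f -> A x -> is_diff x f ('d f x).
Proof. by move=> h /h[+ _] => /differentiableP. Qed.

Lemma C1_on_cvg A f x v : C1_on A f -> A x -> 'd f y v @[y --> x] --> 'd f x v.
Proof. by move=> h /h[_]; apply. Qed.

Lemma C1_on_continuous A f x : C1_on A f -> A x -> {for x, continuous f}.
Proof. by move=> h /h[/differentiable_continuous]. Qed.

Lemma C1_on_cst (A : set V) (c : W) : C1_on A (fun=> c).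
Proof.
move=> x _; split; first exact: differentiable_cst.
by move=> v y; rewrite [X in X @ _](_ : _ = fun=> 0) ?diff_cst;
  [exact: cvg_cst | apply/funext=> z; rewrite diff_cst].
Qed.

Lemma C1_onD A f g : open A -> C1_on A f -> C1_on A g ->
  C1_on A (fun x => f x + g x).
Proof.
move=> oA hf hg; apply: (@C1_onI _ _ (fun x v => 'd f x v + 'd g x v)) => //.
- move=> x Ax; have df := C1_on_is_diff hf Ax; have dg := C1_on_is_diff hg Ax.
  exact: is_diffD.
- by move=> v x Ax; exact: cvgD (C1_on_cvg hf Ax) (C1_on_cvg hg Ax).
Qed.

Lemma C1_on_sum A n (F : 'I_n -> V -> W) : open A ->
  (forall i, C1_on A (F i)) -> C1_on A (fun x => \sum_i F i x).
Proof.
move=> oA; elim: n F => [|n IH] F hF.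
  under [X in C1_on _ X]funext do rewrite big_ord0.
  exact: C1_on_cst.
under [X in C1_on _ X]funext do rewrite big_ord_recl.
by apply: C1_onD => //; apply: IH.
Qed.

End NearDiff.

(** * Products and compositions of [C^1] maps *)

Section Scale.
Context {R : realType} {V W : normedModType R}.

Let scale_is_bilinear : bilinear_for
  (GRing.Scale.Law.clone _ _ *:%R _) (GRing.Scale.Law.clone _ _ *:%R _)
  (@GRing.scale R W : R^o -> W -> W).
Proof.
split=> [u|u] a x y /=; first by rewrite scalerDl -scalerA.
by rewrite scalerDr !scalerA mulrC.
Qed.

HB.instance Definition _ := bilinear_isBilinear.Build R R^o W W _ _
  (@GRing.scale R W : R^o -> W -> W) scale_is_bilinear.

(** The product is the pair [(k, f)] followed by scaling, which is bilinear and continuous, hence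
    differentiable. *)
Lemma is_diff_scale (k dk : V -> R^o) (f df : V -> W) x :
  is_diff x k dk -> is_diff x f df ->
  is_diff x (fun y => k y *: f y) (fun v => k x *: df v + dk v *: f x).
Proof.
move=> hk hf.
have hs (p : R^o * W) : is_diff p (fun q : R^o * W => q.1 *: q.2)
    (fun q => p.1 *: q.2 + q.1 *: p.2).
  apply: DiffDef.
    apply: (differentiable_bilin (f := @GRing.scale R W : R^o -> W -> W)) => ?.
    exact: scale_continuous.
  rewrite (diff_bilin (f := @GRing.scale R W : R^o -> W -> W))// => ?.
  exact: scale_continuous.
exact: (is_diff_comp (is_diff_pair hk hf) (hs _)).
Qed.

Lemma C1_onZ A (k : V -> R^o) (f : V -> W) : open A -> C1_on A k -> C1_on A f ->
  C1_on A (fun x => k x *: f x).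
Proof.
move=> oA hk hf.
apply: (@C1_onI _ _ _ _ _ (fun x v => k x *: 'd f x v + 'd k x v *: f x)) => //.
- move=> x Ax; apply: is_diff_scale; exact: C1_on_is_diff Ax.
- move=> v x Ax; have ck := C1_on_continuous hk Ax.
  have cf := C1_on_continuous hf Ax.
  exact: cvgD (cvgZ ck (C1_on_cvg hf Ax)) (cvgZ (C1_on_cvg hk Ax) cf).
Qed.

End Scale.

Section Comp.
Context {R : realType} {V W : normedModType R}.

Lemma cvg_eq {T : Type} (F : set_system T) (f g : T -> W) (a b : W) :
  f =1 g -> a = b -> f @ F --> a -> g @ F --> b.
Proof. by move=> /funext-> ->. Qed.

Lemma cvg_bigsum {T : Type} (F : set_system T) n (f : 'I_n -> T -> W) l :
  Filter F -> (forall i, f i @ F --> l i) ->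
  \sum_i f i x @[x --> F] --> \sum_i l i.
Proof. by move=> FF fl; apply: cvg_big => //; exact: add_continuous. Qed.

(** Reduces ['d g (a y) (w y)], where the point and the vector both vary, to fixed basis vectors,
    the case that [C1_on] controls. *)
Lemma rV_linear_sum m (l : {linear 'rV[R]_m -> W}) w :
  l w = \sum_i w 0 i *: l (delta_mx 0 i).
Proof. by rewrite {1}[w]row_sum_delta linear_sum; under eq_bigr do rewrite linearZ. Qed.

Lemma C1_on_linear A (l : {linear V -> W}) : continuous l -> C1_on A l.
Proof.
move=> cl x _; split; first exact: linear_differentiable.
by move=> v y; rewrite [X in X @ _](_ : _ = fun=> l v) ?diff_lin//;
  [exact: cvg_cst | apply/funext=> z; rewrite diff_lin].
Qed.

Lemma rV_linear_continuous m (l : {linear 'rV[R]_m -> W}) : continuous l.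
Proof.
rewrite (_ : (l : _ -> _) = fun w : 'rV_m => \sum_i w 0 i *: l (delta_mx 0 i)).
  move=> x; apply: (@cvg_bigsum _ (nbhs x)) => i.
  by apply: cvgZr_tmp; exact: coord_continuous.
by apply/funext => w; exact: rV_linear_sum.
Qed.

Context {m : nat}.

(** Joint continuity of the differential in the point and the vector: expanding the vector in the
    standard basis leaves a finite sum of products of convergent factors. *)
Lemma C1_on_diff_cvg (F : set_system V) B (g : 'rV[R]_m -> W) a w p v : Filter F ->
  C1_on B g -> B p -> a @ F --> p -> w @ F --> v ->
  'd g (a y) (w y) @[y --> F] --> 'd g p v.
Proof.
move=> FF hg Bp ca cw.
apply: (cvg_eq (fun y => esym (rV_linear_sum ('d g (a y)) (w y)))
  (esym (rV_linear_sum ('d g p) v))).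
apply: cvg_bigsum => i; apply: (cvgZ (s := fun y => w y 0 i)).
  exact: cvg_comp cw (@coord_continuous R 1 m 0 i v).
exact: cvg_comp ca (C1_on_cvg (v := delta_mx 0 i) hg Bp).
Qed.

Lemma C1_on_comp A B (f : V -> 'rV[R]_m) (g : 'rV[R]_m -> W) : open A ->
  (forall x, A x -> B (f x)) -> C1_on A f -> C1_on B g ->
  C1_on A (fun x => g (f x)).
Proof.
move=> oA AB hf hg.
apply: (@C1_onI _ _ _ _ _ (fun x v => 'd g (f x) ('d f x v))) => //.
- move=> x Ax; have dg := C1_on_is_diff hg (AB x Ax).
  by have df := C1_on_is_diff hf Ax; exact: is_diff_comp df dg.
- move=> v x Ax.
  apply: (@C1_on_diff_cvg (nbhs x) B g f (fun y => 'd f y v) (f x)) => //.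
  + exact: AB.
  + exact: C1_on_continuous Ax.
  + exact: C1_on_cvg Ax.
Qed.

End Comp.

Section DiffOfC2.
Context {R : realType} {V W : normedModType R} {m : nat}.

Lemma C1_on_coord A (f : V -> 'rV[R]_m) i : open A -> C1_on A f ->
  C1_on A (fun x => f x 0 i : R^o).
Proof.
have lin : linear (fun x : 'rV[R]_m => x 0 i : R^o) by move=> a u v; rewrite !mxE.
pose lM := GRing.isLinear.Build _ _ _ _ _ lin.
pose l : {linear 'rV[R]_m -> R^o} := HB.pack (fun x : 'rV[R]_m => x 0 i : R^o) lM.
move=> oA hf; have cl : C1_on setT l := C1_on_linear (rV_linear_continuous (l := l)).
exact: (C1_on_comp oA (fun _ _ => I) hf cl).
Qed.

(** In the standard basis the map is a finite sum of products of [C^1] functions. One derivative of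
    [g] is spent, which is why [C^2] transition maps preserve [C^1] fields. *)
Lemma C1_on_diff A B (a w : V -> 'rV[R]_m) (g : 'rV[R]_m -> W) : open A ->
  (forall x, A x -> B (a x)) -> C1_on A a -> C1_on A w -> C2_on B g ->
  C1_on A (fun x => 'd g (a x) (w x)).
Proof.
move=> oA AB ha hw [_ hg].
apply: (@eq_C1_on _ _ _ _ (fun x => \sum_i w x 0 i *: 'd g (a x) (delta_mx 0 i))) => //.
  by move=> x _; rewrite -rV_linear_sum.
apply: C1_on_sum => // i; apply: C1_onZ => //; first exact: C1_on_coord.
exact: (C1_on_comp oA AB ha (hg _)).
Qed.

End DiffOfC2.

Section IsDiff.
Context {R : realType} {V W : normedModType R}.

Lemma is_diff_fext (f g df dg : V -> W) x : f =1 g -> df =1 dg ->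
  is_diff x f df -> is_diff x g dg.
Proof. by move=> /funext-> /funext->. Qed.

Lemma is_diff_bigsum n (f df : 'I_n -> V -> W) x :
  (forall i, is_diff x (f i) (df i)) ->
  is_diff x (fun y => \sum_i f i y) (fun v => \sum_i df i v).
Proof.
move=> h; rewrite (_ : (fun y => \sum_i f i y) = \sum_i f i); last first.
  by apply/funext => y; rewrite fct_sumE.
rewrite (_ : (fun y => \sum_i df i y) = \sum_i df i); last first.
  by apply/funext => y; rewrite fct_sumE.
elim: n f df h => [|n IH] f df h.
  by rewrite !big_ord0; exact: is_diff_cst.
rewrite !big_ord_recl; apply: is_diffD; exact: IH.
Qed.

Lemma is_diff_linear m (l : {linear 'rV[R]_m -> W})
    (f df : V -> 'rV[R]_m) x :
  is_diff x f df -> is_diff x (fun y => l (f y)) (fun v => l (df v)).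
Proof.
have cl := rV_linear_continuous (l := l).
move=> hf; have hl : is_diff (f x) l l.
  by apply: DiffDef; [exact: linear_differentiable | exact: diff_lin].
exact: (is_diff_comp hf hl).
Qed.

End IsDiff.

(** * Second derivatives and their symmetry *)

Section SecondDerivative.
Context {R : realType} {V W : normedModType R}.

Lemma is_diff_coord (U : normedModType R) m (w dw : U -> 'rV[R]_m) x i : is_diff x w dw ->
  is_diff x (fun y => w y 0 i : R^o) (fun v => dw v 0 i : R^o).
Proof.
have lin : linear (fun x : 'rV[R]_m => x 0 i : R^o) by move=> a u v; rewrite !mxE.
pose lM := GRing.isLinear.Build _ _ _ _ _ lin.
pose l : {linear 'rV[R]_m -> R^o} := HB.pack (fun x : 'rV[R]_m => x 0 i : R^o) lM.
exact: (is_diff_linear l).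
Qed.

Lemma is_diff_diff m B (w : 'rV[R]_m -> 'rV[R]_m) (g : 'rV[R]_m -> W) x :
  C2_on B g -> B x -> differentiable w x ->
  is_diff x (fun z => 'd g z (w z))
    (fun h => 'd (fun z => 'd g z (w x)) x h + 'd g x ('d w x h)).
Proof.
move=> [_ hg] Bx /differentiableP dw.
have dG i := C1_on_is_diff (hg (delta_mx 0 i)) Bx.
have dZ i : is_diff x (fun z => w x 0 i *: 'd g z (delta_mx 0 i))
    (fun h => w x 0 i *: 'd (fun z => 'd g z (delta_mx 0 i)) x h).
  exact: (is_diffZ (w x 0 i) (dG i)).
have E1 := diff_val (is_diff_def := is_diff_fext
  (fun z => esym (rV_linear_sum ('d g z) (w x))) (frefl _) (is_diff_bigsum dZ)).
apply: (is_diff_fext (fun z => esym (rV_linear_sum ('d g z) (w z))) _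
  (is_diff_bigsum (fun i => is_diff_scale (is_diff_coord i dw) (dG i)))) => h.
apply: etrans (big_split _ _ _ _ _) (congr2 +%R (esym (congr1 (@^~ h) E1)) _).
exact: esym (rV_linear_sum ('d g x) ('d w x h)).
Qed.

Lemma diff_mvt (f : V -> R^o) y v (t : R) : 0 <= t ->
  (forall s, 0 <= s <= t -> differentiable f (y + s *: v)) ->
  exists2 c, 0 <= c <= t & f (y + t *: v) - f y = 'd f (y + c *: v) v * t.
Proof.
move=> t0 df.
have dl (s : R) : is_diff s (fun s : R => y + s *: v) (fun h => h *: v).
  apply: (is_diff_fext _ _ (is_diffD (is_diff_cst y s) (is_diff_scalel s v))) => //.
  by move=> h; exact: add0r.
have dfl s : 0 <= s <= t ->
    is_diff s (fun s : R => f (y + s *: v)) (fun h => 'd f (y + s *: v) (h *: v)).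
  by move=> /df/differentiableP dfs; exact: is_diff_comp (dl s) dfs.
have [||c] := @MVT_segment R (fun s => f (y + s *: v))
    (fun s => 'd f (y + s *: v) v) 0 t t0.
- move=> s /[!in_itv]/= /andP[s0 st].
  have ds := dfl s (introT andP (conj (ltW s0) (ltW st))).
  apply: DeriveDef; first exact/diff_derivable/ex_diff.
  by rewrite deriveE ?diff_val ?scale1r//; exact: ex_diff.
- apply: continuous_in_subspaceT => s /[!inE] /=; rewrite in_itv/= => st.
  have ds := dfl s st.
  exact/differentiable_continuous/ex_diff.
by rewrite in_itv/= subr0 scale0r addr0 => ? ?; exists c.
Qed.

(** The mean value theorem is applied twice: along [u] to [h z = g (z + t *: v) - g z], which gives
    a difference of two values of [z |-> 'd g z u], then along [v] to this last function. *)
Lemma second_difference A (g : V -> R^o) x u v (t : R) : C2_on A g -> 0 <= t ->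
  (forall a b, 0 <= a <= t -> 0 <= b <= t -> A (x + a *: u + b *: v)) ->
  exists a b, [/\ 0 <= a <= t, 0 <= b <= t &
    g (x + t *: u + t *: v) - g (x + t *: u) - (g (x + t *: v) - g x) =
    'd (fun z => 'd g z u : R^o) (x + a *: u + b *: v) v * t * t].
Proof.
move=> [h1 h2] t0 hA.
have tt : 0 <= t <= t by rewrite t0 lexx.
have z0 : 0 <= (0 : R) <= t by rewrite t0 lexx.
pose h z : R^o := g (z + t *: v) - g z.
have dsh z : is_diff z (fun z => z + t *: v) id.
  apply: (is_diff_fext _ _ (is_diffD (is_diff_id z) (is_diff_cst (t *: v) z))) => //.
  by move=> w; exact: addr0.
have dh s : 0 <= s <= t ->
    is_diff (x + s *: u) h
      (('d g (x + s *: u + t *: v) : V -> R^o) - ('d g (x + s *: u) : V -> R^o)).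
  move=> st; have d1 := C1_on_is_diff h1 (hA s t st tt).
  have d2 := C1_on_is_diff h1 (hA s 0 st z0); rewrite scale0r addr0 in d2.
  have d3 := is_diff_comp (dsh _) d1.
  exact: (is_diffB d3 d2).
have [|c ct hE] := @diff_mvt h x u t t0.
  by move=> s /dh ?; exact: ex_diff.
have [|b bt bE] := @diff_mvt (fun z => 'd g z u : R^o) (x + c *: u) v t t0.
  by move=> s st; have [] := h2 u _ (hA c s ct st).
exists c, b; split=> //; rewrite -bE.
have dhc := dh c ct; rewrite diff_val in hE.
by move: hE; rewrite /h => ->.
Qed.

(* The second difference is symmetric in u and v, and divided by t^2 it is a
   value of either mixed derivative at a point close to x. *)
Lemma schwarz_scalar A (g : V -> R^o) x u v : open A -> C2_on A g -> A x ->
  'd (fun z => 'd g z u : R^o) x v = 'd (fun z => 'd g z v : R^o) x u.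
Proof.
move=> oA hg Ax; apply/eqP; rewrite -subr_eq0 -normr_eq0; apply/negPn/negP => ne.
set a := 'd _ x v in ne *; set b := 'd _ x u in ne *.
have e0 : 0 < `|a - b| / 2 by rewrite divr_gt0// lt_neqAle eq_sym ne/=.
have cvA := C1_on_cvg (v := v) (hg.2 u) Ax.
have cvB := C1_on_cvg (v := u) (hg.2 v) Ax.
have : \forall z \near x, [/\ A z,
    `|a - 'd (fun z => 'd g z u : R^o) z v| < `|a - b| / 2 &
    `|b - 'd (fun z => 'd g z v : R^o) z u| < `|a - b| / 2].
  near=> z; split; near: z; first exact: open_nbhs_nbhs.
    by move/cvgrPdist_lt : cvA; apply.
  by move/cvgrPdist_lt : cvB; apply.
move=> /nbhs_ballP[d /= d0 hd].
(* Small enough to keep the whole parallelogram with sides [t *: u] and [t *: v] in the ball of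
   radius [d]; the [+ 1] keeps the denominator positive when [u] and [v] vanish. *)
pose t := d / 2 / (`|u| + `|v| + 1).
have uv0 : 0 < `|u| + `|v| + 1 by rewrite ltr_wpDl// addr_ge0.
have t0 : 0 < t by rewrite !divr_gt0.
(* Stated for [w] and [z] so as to serve both orders of [u] and [v]. *)
have hball r s w z : 0 <= r <= t -> 0 <= s <= t -> `|w| + `|z| = `|u| + `|v| ->
    ball x d (x + r *: w + s *: z).
  move=> /andP[r0 rt] /andP[s0 st] wz; rewrite -ball_normE/= -addrA opprD addNKr.
  rewrite normrN (le_lt_trans (ler_normD _ _))// !normrZ !ger0_norm//.
  apply: (@le_lt_trans _ _ (t * (`|w| + `|z|))).
    by rewrite mulrDr lerD// ler_wpM2r.
  rewrite wz /t mulrAC ltr_pdivrMr//.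
  have : 0 <= d * (`|u| + `|v|) by rewrite mulr_ge0 ?addr_ge0// ltW.
  lra.
have [|r [s [rt st E1]]] := @second_difference A g x u v t hg (ltW t0).
  by move=> r s rt st; have [] := hd _ (hball r s u v rt st erefl).
have [|r' [s' [rt' st' E2]]] := @second_difference A g x v u t hg (ltW t0).
  by move=> r' s' rt' st'; have [] := hd _ (hball r' s' v u rt' st' (addrC _ _)).
have [_ h1 _] := hd _ (hball r s u v rt st erefl).
have [_ _ h2] := hd _ (hball r' s' v u rt' st' (addrC _ _)).
set p := 'd _ (x + r *: u + s *: v) v in E1 h1.
set p' := 'd _ (x + r' *: v + s' *: u) u in E2 h2.
have pp : p = p'.
  have t1 : t != 0 by rewrite gt_eqF.
  apply/(mulIf t1)/(mulIf t1); rewrite -E1 -E2 (addrAC x); ring.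
rewrite -pp in h2; suff : `|a - b| < `|a - b| by rewrite ltxx.
rewrite [ltRHS]splitr (le_lt_trans (ler_distD p _ _))// ltrD// distrC//.
Unshelve. all: by end_near. Qed.

(** Reduces to the scalar case coordinate by coordinate: taking a coordinate commutes with both
    differentiations. *)
Lemma schwarz m A (g : V -> 'rV[R]_m) x u v : open A -> C2_on A g -> A x ->
  'd (fun z => 'd g z u) x v = 'd (fun z => 'd g z v) x u.
Proof.
move=> oA [hg1 hg2] Ax; apply/rowP => i.
have E z w (Az : A z) : 'd (fun z => g z 0 i : R^o) z w = 'd g z w 0 i.
  have dgi := is_diff_coord i (C1_on_is_diff hg1 Az).
  exact: (congr1 (fun f : V -> R^o => f w) (diff_val (is_diff_def := dgi))).
have hgi : C2_on A (fun z => g z 0 i : R^o).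
  split=> [|w]; first exact: C1_on_coord.
  exact: (eq_C1_on oA (fun z Az => esym (E z w Az)) (C1_on_coord i oA (hg2 w))).
have E2 w w' : 'd (fun z => 'd (fun z => g z 0 i : R^o) z w : R^o) x w' =
    'd (fun z => 'd g z w) x w' 0 i.
  have dd := is_diff_coord i (C1_on_is_diff (hg2 w) Ax).
  have nE : {near x, (fun z => 'd g z w 0 i : R^o) =1
      (fun z => 'd (fun z => g z 0 i : R^o) z w : R^o)}.
    by apply: filterS (open_nbhs_nbhs (conj oA Ax)) => z Az; exact: esym (E z w Az).
  have := etrans (near_diff nE (ex_diff (is_diff_def := dd)))
    (diff_val (is_diff_def := dd)).
  exact: (congr1 (fun f : V -> R^o => f w')).
exact: etrans (esym (E2 u v)) (etrans (schwarz_scalar u v oA hgi Ax) (E2 v u)).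
Qed.

End SecondDerivative.

(** * Charts, tangent vectors and vector fields *)

Section Charts.
Context {R : realType} {n : nat} {T : topologicalType} (c : chart R T n).
Implicit Type U : set T.

(** The right-hand side is a preimage under [cinv] cut by the range of the chart, the form in which
    continuity of [cinv] shows openness. *)
Lemma cmap_image U :
  cmap c @` (cdom c `&` U) = [set z | (cmap c @` cdom c) z /\ U (cinv c z)].
Proof.
apply/seteqP; split=> [_ [y [cy Uy] <-]|_ [[y cy <-]]] /=.
  by split; [exists y | rewrite cmapK].
by rewrite cmapK// => Uy; exists y.
Qed.

Lemma near_cinv x (P : T -> Prop) : cdom c x ->
  (\forall y \near x, P y) -> \forall z \near cmap c x, P (cinv c z).
Proof. by move=> cx hP; apply: (cinv_cont cx); rewrite /= cmapK. Qed.

Lemma near_cmap x (Q : 'rV[R]_n -> Prop) : cdom c x ->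
  (\forall z \near cmap c x, Q z) -> \forall y \near x, Q (cmap c y).
Proof. by move=> cx; exact: cmap_cont. Qed.

Lemma open_cmap_image U : open U -> open (cmap c @` (cdom c `&` U)).
Proof.
move=> oU; rewrite openE => _ [y [cy Uy] <-]; rewrite /interior cmap_image.
apply: filterI; last exact: (near_cinv cy (open_nbhs_nbhs (conj oU Uy))).
by apply: open_nbhs_nbhs; split; [exact: cran_open | exists y].
Qed.

Lemma open_nbhs_cmap_image x U : cdom c x -> open_nbhs x U ->
  open_nbhs (cmap c x) (cmap c @` (cdom c `&` U)).
Proof. by move=> cx [oU Ux]; split; [exact: open_cmap_image | exists x]. Qed.

Lemma near_cdom x : cdom c x -> \forall y \near x, cdom c y.
Proof. by move=> cx; apply: open_nbhs_nbhs; split=> //; exact: cdom_open. Qed.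

End Charts.

Section Tangent.
Context {R : realType} {n : nat} {M : C2manifold R n}.
Implicit Types (c d e : chart R M n) (x y : M).

Lemma diff_transition c d x : atlas c -> atlas d -> cdom c x -> cdom d x ->
  is_diff (cmap c x) (cmap d \o cinv c) ('d (cmap d \o cinv c) (cmap c x)).
Proof.
move=> hc hd cx dx; apply: (C1_on_is_diff (atlas_C2 hc hd).1).
by exists x.
Qed.

Lemma diff_transition_id c x (u : 'rV[R]_n) : cdom c x ->
  'd (cmap c \o cinv c) (cmap c x) u = u.
Proof.
move=> cx; rewrite (@near_diff _ _ _ id) ?diff_val//.
have : \forall z \near cmap c x, (cmap c @` cdom c) z.
  by apply: open_nbhs_nbhs; split; [exact: cran_open | exists x].
by apply: filterS => _ [y cy <-] /=; rewrite cmapK.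
Qed.

(** Chain rule: the composite of the two transition maps agrees with the direct one near [cmap c x],
    where the intermediate point stays in the domain of [d]. *)
Lemma diff_transition_comp c d e x u : atlas c -> atlas d -> atlas e ->
  cdom c x -> cdom d x -> cdom e x ->
  'd (cmap e \o cinv d) (cmap d x) ('d (cmap d \o cinv c) (cmap c x) u) =
  'd (cmap e \o cinv c) (cmap c x) u.
Proof.
move=> hc hd he cx dx ex.
have d1 := diff_transition hc hd cx dx.
have d2 := diff_transition hd he dx ex.
have E : (cmap d \o cinv c) (cmap c x) = cmap d x by rewrite /= cmapK.
rewrite -E in d2.
have d3 := is_diff_comp d1 d2.
rewrite [in RHS](@near_diff _ _ _ _ _ _ _ (ex_diff (is_diff_def := d3))).
  have dE := diff_val (is_diff_def := d3).
  by rewrite [in RHS]dE -E.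
apply: (near_cinv (P := fun y => cmap e (cinv d (cmap d y)) = cmap e y)) => //.
by apply: filterS (near_cdom dx) => y dy; rewrite cmapK.
Qed.

Lemma tcompB x (v w : tangent x) c : (v - w) c = v c - w c.
Proof. by rewrite addrC -scaleN1r tcomp_linear scaleN1r addrC. Qed.

Lemma tangent_transition x (v : tangent x) c d : atlas c -> atlas d ->
  cdom c x -> cdom d x -> v d = 'd (cmap d \o cinv c) (cmap c x) (v c).
Proof. by move=> hc hd cx dx; have /asboolP[+ _] := tcompP v; exact. Qed.

Lemma tangent_inj x (v w : tangent x) c : atlas c -> cdom c x ->
  v c = w c -> v = w.
Proof.
move=> hc cx vw; apply/val_inj/funext => d /=.
have /asboolP[_ v0] := tcompP v; have /asboolP[_ w0] := tcompP w.
have [[hd dx]|nd] := pselect (atlas d /\ cdom d x); last by rewrite v0 ?w0.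
by rewrite !(tangent_transition _ hc hd cx dx) vw.
Qed.

(** Transporting [u] to the other charts by the transition differentials is consistent by
    [diff_transition_comp]. With [tangent_inj], the component in one chart identifies the tangent
    space with the row vectors. *)
Lemma tangent_exists c x (u : 'rV[R]_n) : atlas c -> cdom c x ->
  exists v : tangent x, v c = u.
Proof.
move=> hc cx.
pose f d := if `[< atlas d /\ cdom d x >]
  then 'd (cmap d \o cinv c) (cmap c x) u else 0.
have fE d : atlas d -> cdom d x -> f d = 'd (cmap d \o cinv c) (cmap c x) u.
  by move=> hd dx; rewrite /f asboolT.
have fP : f \in tangent_pred x.
  apply/asboolP; split=> [d e hd he dx ex|d nd]; last by rewrite /f asboolF.
  rewrite (fE d hd dx) (fE e he ex).
  exact: esym (diff_transition_comp u hc hd he cx dx ex).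
exists (Tangent fP).
exact: etrans (fE c hc cx) (diff_transition_id u cx).
Qed.

(** Fields are total, so a value is needed everywhere; by [tangent_exists] the default [0] can be
    reached only if [y] is outside [cdom c] or [c] outside the atlas. *)
Definition tangent_of c (u : 'rV[R]_n) y : tangent y :=
  xget (0 : tangent y) [set v : tangent y | v c = u].

Lemma tangent_ofE c u y : atlas c -> cdom c y -> tangent_of c u y c = u.
Proof.
move=> hc cy; rewrite /tangent_of; case: xgetP => //= h.
by have [v /h] := tangent_exists u hc cy.
Qed.

End Tangent.

(** * Brackets of fields related by a [C^2] map *)

Section RelatedFields.
Context {R : realType} {m n : nat}.
Variables (A : set 'rV[R]_m) (g : 'rV[R]_m -> 'rV[R]_n).
Hypotheses (oA : open A) (gC2 : C2_on A g).

(** Differentiates the relation between [X] and [X'] at [x] along [u]: the chain rule on one side,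
    [is_diff_diff] on the other. *)
Lemma diff_related (X : 'rV[R]_m -> 'rV[R]_m) (X' : 'rV[R]_n -> 'rV[R]_n) x u :
  (forall z, A z -> X' (g z) = 'd g z (X z)) -> A x ->
  differentiable X x -> differentiable X' (g x) ->
  'd X' (g x) ('d g x u) =
  'd (fun z => 'd g z (X x)) x u + 'd g x ('d X x u).
Proof.
move=> XX' Ax dX dX'.
have dg := ex_diff (is_diff_def := C1_on_is_diff gC2.1 Ax).
have d2 := is_diff_diff gC2 Ax dX.
have dXg : {near x, (fun z => 'd g z (X z)) =1 X' \o g}.
  by apply: filterS (open_nbhs_nbhs (conj oA Ax)) => z /XX' /esym.
have E1 := near_diff dXg (ex_diff (is_diff_def := d2)).
have E2 := diff_val (is_diff_def := d2).
have E3 := diff_comp dg dX'.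
exact: (congr1 (@^~ u) (etrans (esym E3) (etrans E1 E2))).
Qed.

(** By [diff_related] each half of the bracket acquires a second derivative of [g] at [x], evaluated
    on [X x] and [Y x] in one order or the other; by [schwarz] these terms cancel. *)
Lemma bracket_related (X Y : 'rV[R]_m -> 'rV[R]_m) (X' Y' : 'rV[R]_n -> 'rV[R]_n) x :
  (forall z, A z -> X' (g z) = 'd g z (X z)) ->
  (forall z, A z -> Y' (g z) = 'd g z (Y z)) -> A x ->
  differentiable X x -> differentiable Y x ->
  differentiable X' (g x) -> differentiable Y' (g x) ->
  'd Y' (g x) (X' (g x)) - 'd X' (g x) (Y' (g x)) =
  'd g x ('d Y x (X x) - 'd X x (Y x)).
Proof.
move=> XX' YY' Ax dX dY dX' dY'.
have eY := diff_related (X x) YY' Ax dY dY'.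
have eX := diff_related (Y x) XX' Ax dX dX'.
have e1 := etrans (congr1 ('d Y' (g x)) (XX' x Ax)) eY.
have e2 := etrans (congr1 ('d X' (g x)) (YY' x Ax)) eX.
have key (a b a' b' : 'rV[R]_n) : a = a' -> (a + b) - (a' + b') = b - b'.
  by move=> ->; rewrite opprD addrACA subrr add0r.
apply: etrans (congr2 (fun a b => a - b) e1 e2) _.
exact: etrans (key _ _ _ _ (schwarz (Y x) (X x) oA gC2 Ax))
  (esym (linearB ('d g x) _ _)).
Qed.

End RelatedFields.

(** * Vector fields and brackets read in charts *)

Section Fields.
Context {R : realType} {n : nat} {M : C2manifold R n}.
Implicit Types (c d e : chart R M n) (x y : M) (X Y : forall y : M, tangent y).

Definition field_in c X z : 'rV[R]_n := X (cinv c z) c.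

Lemma field_in_cmap c X x : cdom c x -> field_in c X (cmap c x) = X x c.
Proof. by move=> cx; rewrite /field_in cmapK. Qed.

(** In another chart the field is the image of its reading in [c] under the differential of a [C^2]
    transition map, so [C1_on_diff] applies. *)
Lemma C1_field_on_chart c U X : atlas c -> open U -> U `<=` cdom c ->
  C1_on (cmap c @` U) (field_in c X) -> C1_field_on U X.
Proof.
move=> hc oU Uc hX d hd.
have oA := open_cmap_image (c := d) oU.
have ha : C1_on (cmap d @` (cdom d `&` U)) (cmap c \o cinv d).
  apply: C1_on_sub (atlas_C2 hd hc).1.
  by move=> _ [y [dy /Uc cy] <-]; exists y.
pose f z := 'd (cmap d \o cinv c) ((cmap c \o cinv d) z)
    (field_in c X ((cmap c \o cinv d) z)).
apply: (@eq_C1_on _ _ _ _ f _ oA).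
  move=> _ [y [dy Uy] <-]; have cy := Uc _ Uy.
  rewrite /f [(cmap c \o cinv d) _]/= (cmapK dy) (field_in_cmap _ cy).
  exact: esym (tangent_transition _ hc hd cy dy).
apply: (C1_on_diff oA _ ha _ (atlas_C2 hc hd)).
  by move=> _ [y [dy Uy] <-]; exists y; [split=> //; exact: Uc | rewrite /= cmapK].
apply: (C1_on_comp oA _ ha hX).
by move=> _ [y [dy Uy] <-]; exists y; rewrite //= cmapK.
Qed.

(** Allows fields to be built and tested in a single chart around [x]. *)
Lemma C1_field_nearP c x X : atlas c -> cdom c x ->
  C1_field_near x X <->
  exists2 A, open_nbhs (cmap c x) A & C1_on A (field_in c X).
Proof.
move=> hc cx; split=> [[U Ux hX]|[A [oA Ax] hX]].
  by exists (cmap c @` (cdom c `&` U)); [exact: open_nbhs_cmap_image | exact: hX].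
have oU : open (cdom c `&` cmap c @^-1` A).
  rewrite openE => y [cy Ay]; apply: filterI; first exact: near_cdom.
  exact: (near_cmap cy (open_nbhs_nbhs (conj oA Ay))).
exists (cdom c `&` cmap c @^-1` A); first by split.
apply: (C1_field_on_chart hc oU); first by move=> y [].
by apply: C1_on_sub hX => _ [y [_ Ay] <-].
Qed.

Lemma C1_field_diff c x X : atlas c -> cdom c x -> C1_field_near x X ->
  is_diff (cmap c x) (field_in c X) ('d (field_in c X) (cmap c x)).
Proof.
move=> hc cx /(C1_field_nearP _ hc cx)[A [_ Ax]] hX; exact: C1_on_is_diff Ax.
Qed.

(** The coefficient is a function of the coordinates, which covers constants as well as functions
    extended off [N] through a slice chart. *)
Lemma C1_field_near_scale_add c x X Y (k : 'rV[R]_n -> R^o) A :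
  atlas c -> cdom c x -> open_nbhs (cmap c x) A -> C1_on A k ->
  C1_field_near x X -> C1_field_near x Y ->
  C1_field_near x (fun y => k (cmap c y) *: X y + Y y).
Proof.
move=> hc cx Ax hk /(C1_field_nearP _ hc cx)[B Bx hX].
move=> /(C1_field_nearP _ hc cx)[C Cx hY]; apply/(C1_field_nearP _ hc cx).
pose D := A `&` (B `&` (C `&` (cmap c @` cdom c))).
have Dx : open_nbhs (cmap c x) D.
  do 3 apply: open_nbhsI => //; split; first exact: cran_open.
  by exists x.
have oD := Dx.1; exists D; first exact: Dx.
have hX' : C1_on D (field_in c X) by apply: C1_on_sub hX => z [_ []].
have hY' : C1_on D (field_in c Y) by apply: C1_on_sub hY => z [_ [_ []]].
have hk' : C1_on D k by apply: C1_on_sub hk => z [].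
apply: (eq_C1_on oD _ (C1_onD oD (C1_onZ oD hk' hX') hY')).
by move=> _ [_ [_ [_ [y cy <-]]]]; rewrite /field_in !cmapK// tcomp_linear.
Qed.

Lemma C1_field_near_comb x X Y (a : R) :
  C1_field_near x X -> C1_field_near x Y ->
  C1_field_near x (fun y => a *: X y + Y y).
Proof.
have [c hc cx] := atlas_cover x => hX hY.
apply: (C1_field_near_scale_add (A := setT) (k := fun=> a) hc cx) => //.
  by split=> //; exact: openT.
exact: C1_on_cst.
Qed.

Lemma near_C1_field x X Y : (\forall y \near x, X y = Y y) ->
  C1_field_near x X -> C1_field_near x Y.
Proof.
have [c hc cx] := atlas_cover x => XY /(C1_field_nearP _ hc cx)[A Ax hX].
apply/(C1_field_nearP _ hc cx).
have : nbhs (cmap c x) [set z | X (cinv c z) = Y (cinv c z)] := near_cinv cx XY.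
rewrite nbhsE => -[B Bx {}XY].
have ABx := open_nbhsI Ax Bx; exists (A `&` B) => //.
have hX' : C1_on (A `&` B) (field_in c X) by apply: C1_on_sub hX => z [].
apply: (eq_C1_on ABx.1 _ hX').
by move=> z [_ /XY]; rewrite /field_in /= => ->.
Qed.

Definition bracket_in c X Y x : 'rV[R]_n :=
  'd (field_in c Y) (cmap c x) (X x c) - 'd (field_in c X) (cmap c x) (Y x c).

(** The readings of a field in two charts are related by the transition map, so this is
    [bracket_related]. *)
Lemma bracket_transition c d X Y x : atlas c -> atlas d ->
  cdom c x -> cdom d x -> C1_field_near x X -> C1_field_near x Y ->
  bracket_in d X Y x = 'd (cmap d \o cinv c) (cmap c x) (bracket_in c X Y x).
Proof.
move=> hc hd cx dx hX hY.
have E (Z : forall y, tangent y) z : (cmap c @` (cdom c `&` cdom d)) z ->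
    field_in d Z ((cmap d \o cinv c) z) = 'd (cmap d \o cinv c) z (field_in c Z z).
  move=> [y [cy dy] <-].
  rewrite [(_ \o _) _]/= (cmapK cy) (field_in_cmap _ dy) (field_in_cmap _ cy).
  exact: tangent_transition _ hc hd cy dy.
have gx : (cmap d \o cinv c) (cmap c x) = cmap d x by rewrite [LHS]/= cmapK.
have dX := ex_diff (is_diff_def := C1_field_diff hd dx hX).
have dY := ex_diff (is_diff_def := C1_field_diff hd dx hY).
rewrite -gx in dX dY.
have Ax : (cmap c @` (cdom c `&` cdom d)) (cmap c x) by exists x.
have := bracket_related (open_cmap_image (@cdom_open _ _ _ d)) (atlas_C2 hc hd)
  (E X) (E Y) Ax (ex_diff (is_diff_def := C1_field_diff hc cx hX))
  (ex_diff (is_diff_def := C1_field_diff hc cx hY)) dX dY.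
by rewrite gx (field_in_cmap X cx) (field_in_cmap Y cx) (field_in_cmap X dx)
  (field_in_cmap Y dx).
Qed.

(** The value computed in one chart defines a tangent vector, and [bracket_transition] says that its
    other components are the brackets computed there. *)
Lemma lie_bracket_exists X Y x : C1_field_near x X -> C1_field_near x Y ->
  exists Z : tangent x, is_lie_bracket X Y Z.
Proof.
have [c hc cx] := atlas_cover x => hX hY.
exists (tangent_of c (bracket_in c X Y x) x) => d hd dx.
rewrite -/(bracket_in d X Y x) (bracket_transition hc hd)//.
by rewrite (tangent_transition _ hc hd)// tangent_ofE.
Qed.

End Fields.

(** * Derivatives of functions vanishing on a slice *)

Section Flat.
Context {R : realType} {p q : nat} {W : normedModType R}.

(** Projection onto the slice along the transverse coordinates. Composition with it turns vanishing
    on the slice into vanishing on a neighbourhood. *)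
Definition flatten_mx (z : 'rV[R]_(p + q)) : 'rV[R]_(p + q) :=
  row_mx (lsubmx z) 0.

Fact flatten_mx_linear : linear flatten_mx.
Proof.
by move=> a u v; rewrite /flatten_mx linearP scale_row_mx add_row_mx scaler0 addr0.
Qed.
HB.instance Definition _ :=
  GRing.isLinear.Build _ _ _ _ flatten_mx flatten_mx_linear.

Lemma flatten_mx_id z : rsubmx z = 0 -> flatten_mx z = z.
Proof. by move=> z0; rewrite -[RHS]hsubmxK z0. Qed.

(** Near [z] the map [h \o flatten_mx] is zero, so its differential ['d h z \o flatten_mx] is zero,
    and [flatten_mx] fixes [u]. *)
Lemma diff_flat (h : 'rV[R]_(p + q) -> W) z u : differentiable h z ->
  rsubmx z = 0 -> (\forall y \near z, rsubmx y = 0 -> h y = 0) ->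
  rsubmx u = 0 -> 'd h z u = 0.
Proof.
move=> dh z0 h0 u0.
have cL := rV_linear_continuous (l := flatten_mx).
have dL : is_diff z flatten_mx flatten_mx.
  by apply: DiffDef; [exact: linear_differentiable | exact: diff_lin].
have Lz := flatten_mx_id z0.
have dhL : is_diff (flatten_mx z) h ('d h z).
  by rewrite Lz; exact: differentiableP.
have dc := is_diff_comp dL dhL.
have nE : {near z, cst 0 =1 h \o flatten_mx}.
  have cLz : flatten_mx y @[y --> z] --> z.
    by rewrite -[X in _ --> X]Lz; exact: (cL z).
  have : \forall y \near z, rsubmx (flatten_mx y) = 0 -> h (flatten_mx y) = 0.
    exact: (cLz _ h0).
  apply: filterS => y hy.
  exact: esym (hy (row_mxKr _ _)).
have E1 := diff_val (is_diff_def := dc).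
have E2 := near_diff nE (@differentiable_cst R _ W 0 z).
have E3 := diff_cst (V := 'rV[R]_(p + q)) (0 : W) z.
have := congr1 (fun f : 'rV[R]_(p + q) -> W => f u) (etrans (esym E1) (etrans E2 E3)).
by rewrite /= (flatten_mx_id u0).
Qed.

End Flat.

(** * Frames and combinations with variable coefficients *)

Section Frame.
Context {R : realType}.

(** Independence makes the matrix with rows [F i] row free; the columns of a right inverse are the
    dual covectors. *)
Lemma dual_frame n r (F : 'I_r -> 'rV[R]_n) :
  (forall a : 'I_r -> R, \sum_i a i *: F i = 0 -> forall i, a i = 0) ->
  exists B : 'M[R]_(n, r), forall i j, (F i *m B) 0 j = (i == j)%:R.
Proof.
move=> indF; pose A := \matrix_i F i.
have /row_freeP[B AB] : row_free A.
  rewrite -kermx_eq0; apply/rowV0P => v /sub_kermxP vA.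
  apply/rowP => i; rewrite mxE; apply: (indF (v 0)).
  by rewrite -[RHS]vA mulmx_sum_row; apply: eq_bigr => j _; rewrite rowK.
exists B => i j; have <- : row i A = F i by apply/rowP => k; rewrite !mxE.
by rewrite -row_mul AB !mxE.
Qed.

(* Pairing D with a dual frame at z gives a = e - (a m), where e -> 0 because
   D z = 0 and m -> 0 because F is continuous; hence sum |a_i| <= 2 sum |e_i|. *)
Lemma frame_coef_cvg0 (V : normedModType R) n r (F : 'I_r -> V -> 'rV[R]_n)
    (D : V -> 'rV[R]_n) (a : V -> 'I_r -> R) z :
  (forall b : 'I_r -> R, \sum_i b i *: F i z = 0 -> forall i, b i = 0) ->
  (forall i, {for z, continuous (F i)}) -> {for z, continuous D} -> D z = 0 ->
  (\forall y \near z, D y = \sum_i a y i *: F i y) ->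
  forall i, a y i @[y --> z] --> 0.
Proof.
move=> indF cF cD D0 DE i.
have [B FB] := dual_frame indF.
have cB (f : V -> 'rV[R]_n) k : {for z, continuous f} ->
    (f y *m B) 0 k @[y --> z] --> (f z *m B) 0 k.
  move=> cf.
  have cBf := cvg_comp _ _ cf (rV_linear_continuous (l := mulmxr B) (x := f z)).
  exact: cvg_comp cBf (@coord_continuous R 1 r 0 k (f z *m B)).
apply/cvgrPdist_lt => e e0.
have r0 : 0 < r%:R :> R by rewrite ltr0n (leq_ltn_trans _ (ltn_ord i)).
(* The bounds carry a factor [1 / r] because they are summed over [k]: here the sum stays below
   [e / 2], and in [nF] each sum over [k] is at most [1 / 2]. *)
have nD : \forall y \near z, forall k, `|(D y *m B) 0 k| < e / 2 / r%:R.
  apply: filter_forall => k; have := cB D k cD.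
  rewrite D0 mul0mx mxE => /cvgrPdist_lt/(_ (e / 2 / r%:R)).
  rewrite !divr_gt0// => /(_ isT); apply: filterS => y.
  by rewrite sub0r normrN.
have nF : \forall y \near z, forall j k,
    `|(j == k)%:R - (F j y *m B) 0 k| < 2^-1 / r%:R.
  apply: filter_forall => j; apply: filter_forall => k.
  have := cB (F j) k (cF j); rewrite FB => /cvgrPdist_lt; apply.
  by rewrite divr_gt0.
near=> y.
pose S := \sum_k `|a y k|.
have aE k : a y k = (D y *m B) 0 k + \sum_j a y j * ((j == k)%:R - (F j y *m B) 0 k).
  have -> : D y = \sum_j a y j *: F j y by near: y.
  have sE j : (a y j *: F j y *m B) 0 k = a y j * (F j y *m B) 0 k.
    by rewrite -scalemxAl [LHS]mxE.
  rewrite mulmx_suml summxE -big_split/= (bigD1 k)//= big1 ?addr0.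
    by rewrite eqxx sE mulr1n; ring.
  by move=> j /negPf jk; rewrite jk sE mulr0n; ring.
have hD k : `|(D y *m B) 0 k| < e / 2 / r%:R by move: k; near: y.
have hF j k : `|(j == k)%:R - (F j y *m B) 0 k| < 2^-1 / r%:R.
  by move: j k; near: y.
have sumr (b : R) : \sum_(k < r) b / r%:R = b.
  by rewrite sumr_const card_ord -[LHS]mulr_natr divfK// gt_eqF.
have SE : S <= \sum_k `|(D y *m B) 0 k| + 2^-1 * S.
  apply: (@le_trans _ _ (\sum_k (`|(D y *m B) 0 k| +
      \sum_j `|a y j| * `|(j == k)%:R - (F j y *m B) 0 k|))).
    apply: ler_sum => k _; rewrite {1}aE (le_trans (ler_normD _ _))// lerD2l.
    by rewrite (le_trans (ler_norm_sum _ _ _))//; under eq_bigr do rewrite normrM.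
  rewrite big_split/= lerD2l exchange_big/= mulr_sumr ler_sum// => j _.
  rewrite -mulr_sumr mulrC ler_wpM2r// -[leRHS]sumr ler_sum// => k _.
  exact: ltW.
have : \sum_k `|(D y *m B) 0 k| < e / 2.
  rewrite -[ltRHS]sumr; apply: ltr_sum => [|k _]; last exact: hD.
  by apply/hasP; exists i => //; rewrite mem_index_enum.
rewrite sub0r normrN.
have : `|a y i| <= S by rewrite /S (bigD1 i)//= lerDl sumr_ge0.
lra.
Unshelve. all: by end_near. Qed.

(** Since [l (F i z) = 0], the difference quotient of [l \o D] along [w] is the sum of those of the
    [l \o F i], weighted by the coefficients at [t *: w + z]. The quotients converge and the
    coefficients tend to 0 by [frame_coef_cvg0]. *)
Lemma diff_frame_vanish (V : normedModType R) n m r (F : 'I_r -> V -> 'rV[R]_n)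
    (D : V -> 'rV[R]_n) (l : {linear 'rV[R]_n -> 'rV[R]_m}) z w :
  (forall b : 'I_r -> R, \sum_i b i *: F i z = 0 -> forall i, b i = 0) ->
  (forall i, differentiable (F i) z) -> differentiable D z -> D z = 0 ->
  (\forall y \near z, exists a : 'I_r -> R, D y = \sum_i a i *: F i y) ->
  (forall i, l (F i z) = 0) -> l ('d D z w) = 0.
Proof.
move=> indF dF dD D0 DE lF.
(* A total coefficient function, equal to [0] at points where [D y] is not in the span; the
   expansion holds near [z]. *)
have [y|a aE] := @choice V ('I_r -> R) (fun y a =>
    (exists b : 'I_r -> R, D y = \sum_i b i *: F i y) -> D y = \sum_i a i *: F i y).
  have [[b bE]|nb] := pselect (exists b : 'I_r -> R, D y = \sum_i b i *: F i y).
    by exists b.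
  by exists (fun=> 0) => /nb.
have {}aE : \forall y \near z, D y = \sum_i a y i *: F i y by apply: filterS DE.
have a0 : forall i, a y i @[y --> z] --> 0.
  apply: (frame_coef_cvg0 indF _ _ D0 aE) => [i|]; exact: differentiable_continuous.
have dlD := is_diff_linear l (differentiableP dD).
have dlF i := is_diff_linear l (differentiableP (dF i)).
have cz : t *: w + z @[t --> 0^'] --> z.
  have cz0 : t *: w + z @[t --> (0 : R)] --> 0 *: w + z.
    by apply: cvgD; [exact: cvgZr_tmp cvg_id | exact: cvg_cst].
  rewrite scale0r add0r in cz0.
  apply: cvg_trans cz0; apply: cvg_app; exact: cvg_within.
have E := deriveE w (ex_diff (is_diff_def := dlD)).
have E' := congr1 (fun f : V -> 'rV[R]_m => f w) (diff_val (is_diff_def := dlD)).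
apply: etrans (esym E') (etrans (esym E) _).
apply: cvg_lim => //.
have cF i : t^-1 *: (l (F i (t *: w + z)) - l (F i z)) @[t --> 0^'] -->
    'D_w (fun y => l (F i y)) z.
  exact: (diff_derivable (ex_diff (is_diff_def := dlF i))).
have : \sum_i a (t *: w + z) i *: (t^-1 *: (l (F i (t *: w + z)) - l (F i z)))
    @[t --> 0^'] --> \sum_i (0 : R) *: 'D_w (fun y => l (F i y)) z.
  apply: cvg_bigsum => i; apply: cvgZ (cF i).
  exact: cvg_comp cz (a0 i).
rewrite big1; last by move=> i _; exact: scale0r.
apply: cvg_trans; apply: near_eq_cvg.
have : \forall t \near 0^',
    D (t *: w + z) = \sum_i a (t *: w + z) i *: F i (t *: w + z).
  exact: (cz _ aE).
apply: filterS => t /= ->.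
rewrite D0 linear0 subr0 linear_sum scaler_sumr; apply: eq_bigr => i _.
by rewrite lF subr0 (linearZ_LR l) !scalerA mulrC.
Qed.

End Frame.

(** * Slice charts and the normal bundle *)

Section SliceCharts.
Context {R : realType} {p q : nat} {M : C2manifold R (p + q)} {N : set M}.
Implicit Types (c d : chart R M (p + q)) (x y : M) (X Y : forall y : M, tangent y).

Lemma slice_rsubmx c x : slice_chart N c -> cdom c x -> N x -> rsubmx (cmap c x) = 0.
Proof. by move=> [_ cN] cx /(cN _ cx). Qed.

(** Within the range of a slice chart the zeros of [rsubmx] are exactly the images of points of [N].
    This turns properties along [N] into the hypothesis of [diff_flat]. *)
Lemma near_slice c x (P : M -> Prop) : slice_chart N c -> cdom c x ->
  (\forall y \near x, N y -> P y) ->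
  \forall z \near cmap c x, rsubmx z = 0 -> P (cinv c z).
Proof.
move=> [_ cN] cx /(filterI (near_cdom cx))/(near_cinv cx).
have : nbhs (cmap c x) (cmap c @` cdom c).
  by apply: open_nbhs_nbhs; split; [exact: cran_open | exists x].
apply: filterS2 => _ [y cy <-]; rewrite cmapK// => -[_ Py] /(cN _ cy).
exact: Py.
Qed.

(** Both charts flatten [N], so the transverse part of the transition map vanishes on the slice and
    [diff_flat] applies to it. *)
Lemma slice_transition_rsubmx c d x (u : 'rV[R]_(p + q)) :
  slice_chart N c -> slice_chart N d -> cdom c x -> cdom d x -> N x ->
  rsubmx u = 0 -> rsubmx ('d (cmap d \o cinv c) (cmap c x) u) = 0.
Proof.
move=> hc hd cx dx Nx u0.
have dg := diff_transition hc.1 hd.1 cx dx.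
have drg := is_diff_linear (rsubmx : {linear 'rV[R]_(p + q) -> 'rV[R]_q}) dg.
have := diff_flat (ex_diff (is_diff_def := drg)) (slice_rsubmx hc cx Nx) _ u0.
rewrite (diff_val (is_diff_def := drg)); apply.
apply: (near_slice (P := fun y => rsubmx (cmap d y) = 0) hc cx).
by apply: filterS (near_cdom dx) => y dy Ny; exact: slice_rsubmx.
Qed.

(** One slice chart suffices to test tangency, since transition differentials preserve the
    condition. *)
Lemma tangentNE c x (v : tangent x) : slice_chart N c -> cdom c x -> N x ->
  (v \in tangentN_pred N x) = (rsubmx (v c) == 0).
Proof.
move=> hc cx Nx; apply/asboolP/eqP => [->//|v0 d hd dx].
rewrite (tangent_transition v hc.1 hd.1 cx dx).
exact: slice_transition_rsubmx hc hd cx dx Nx v0.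
Qed.

(** Thus the last [q] components in one slice chart serve as coordinates on the fibre of the normal
    bundle. *)
Lemma normal_class_eq c x (v w : tangent x) : slice_chart N c -> cdom c x -> N x ->
  normal_class N v = normal_class N w <-> rsubmx (v c) = rsubmx (w c).
Proof.
move=> hc cx Nx; split=> [/eqP|vw].
  rewrite /normal_class pi_lquot_eq => vw.
  have : v - w \in tangentN_pred N x by [].
  by rewrite (tangentNE _ hc cx Nx) tcompB linearB/= subr_eq0 => /eqP.
apply/eqP; rewrite /normal_class pi_lquot_eq.
have : v - w \in tangentN_pred N x; last by [].
by rewrite (tangentNE _ hc cx Nx) tcompB linearB/= subr_eq0 vw.
Qed.

Lemma normal_classP c x (v : tangent x) (e : normal N x) :
  slice_chart N c -> cdom c x -> N x ->
  normal_class N v = e <-> rsubmx (v c) = normal_comp c e.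
Proof.
move=> hc cx Nx; rewrite -(normal_class_eq _ _ hc cx Nx).
by have -> : normal_class N (repr (e : lquot (tangentN_pred N x))) = e by exact: reprK.
Qed.

Lemma normal_class_linear x : linear (@normal_class R p q M N x).
Proof.
move=> a v w; apply: etrans (pi_lquotD _ _ _) _; congr (_ + _).
exact: (pi_lscale (tangentN_pred N x)).
Qed.
HB.instance Definition _ x := GRing.isLinear.Build R (tangent x) (normal N x) _
  (@normal_class R p q M N x) (@normal_class_linear x).

Lemma slice_pt_lsubmx c x : slice_chart N c -> cdom c x -> N x ->
  slice_pt c (lsubmx (cmap c x)) = x.
Proof.
move=> hc cx Nx; rewrite /slice_pt -[row_mx _ _]/(flatten_mx _).
by rewrite (flatten_mx_id (slice_rsubmx hc cx Nx)) cmapK.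
Qed.

(* The neighbourhood of cmap c x on which a function given along the slice is
   extended to be constant in the transverse directions. *)
Definition slice_nbhs c U : set 'rV[R]_(p + q) :=
  (cmap c @` cdom c) `&` lsubmx @^-1` (slice_dom c U).

Lemma open_nbhs_slice_nbhs c x U : slice_chart N c -> cdom c x -> N x ->
  open_nbhs x U -> open_nbhs (cmap c x) (slice_nbhs c U).
Proof.
move=> hc cx Nx Ux; have oc := @cran_open _ _ _ c.
have [oA Ax] := open_nbhs_cmap_image cx Ux.
have -> : slice_nbhs c U = (cmap c @` cdom c) `&`
  flatten_mx @^-1` (cmap c @` (cdom c `&` U)) by [].
split; last by split; [exists x | rewrite /= (flatten_mx_id (slice_rsubmx hc cx Nx))].
apply: openI => //; apply: open_comp => // z _.
exact: (rV_linear_continuous (l := flatten_mx)).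
Qed.

Lemma C1_slice_extension (V : normedModType R) c U (f : 'rV[R]_p -> V) :
  open (slice_nbhs c U) -> C1_on (slice_dom c U) f ->
  C1_on (slice_nbhs c U) (fun z => f (lsubmx z)).
Proof.
move=> oU hf; apply: (C1_on_comp oU _ _ hf) => [z []//|].
exact: C1_on_linear (rV_linear_continuous (l := lsubmx)).
Qed.

Lemma lifting_exists x (eta : forall y, normal N y) : C2_submanifold N -> N x ->
  C1_normal_near x eta -> exists Y, lifting_near x eta Y.
Proof.
move=> hN Nx [U Ux heta]; have [c hc cx] := hN x Nx.
(* In the slice chart the lifting has no component along the slice, and its transverse part is that
   of [eta] at the projected point, constant in the transverse coordinates. *)
pose W (z : 'rV[R]_(p + q)) : 'rV[R]_(p + q) :=
  row_mx 0 (normal_comp c (eta (slice_pt c (lsubmx z)))).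
exists (fun y => tangent_of c (W (cmap c y)) y); have hc1 := hc.1; split.
  apply/(C1_field_nearP _ hc1 cx).
  have Ax := open_nbhs_slice_nbhs hc cx Nx Ux.
  exists (slice_nbhs c U) => //.
  apply: (@eq_C1_on _ _ _ _ W _ Ax.1).
    by move=> _ [[y cy <-] _]; rewrite field_in_cmap// tangent_ofE.
  have lin : linear (row_mx 0 : 'rV[R]_q -> 'rV[R]_(p + q)).
    by move=> a u v; rewrite scale_row_mx add_row_mx scaler0 addr0.
  pose lM := GRing.isLinear.Build _ _ _ _ _ lin.
  pose l : {linear 'rV[R]_q -> 'rV[R]_(p + q)} :=
    HB.pack (row_mx 0 : 'rV[R]_q -> 'rV[R]_(p + q)) lM.
  have hl : C1_on setT l := C1_on_linear (rV_linear_continuous (l := l)).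
  exact: (C1_on_comp Ax.1 (fun _ _ => I) (C1_slice_extension Ax.1 (heta c hc)) hl).
apply: filterS (near_cdom cx) => y cy Ny; apply/(normal_classP _ _ hc cy Ny).
by rewrite tangent_ofE// row_mxKr slice_pt_lsubmx.
Qed.

End SliceCharts.

(** * Local sections of the subbundle *)

Section Sections.
Context {R : realType} {n r : nat} {M : C2manifold R n}.
Implicit Types (x y : M) (X Y : forall y : M, tangent y).

Lemma tcomp0 x (c : chart R M n) : (0 : tangent x) c = 0.
Proof.
by have := tcomp_linear c 0 (0 : tangent x) 0; rewrite !scale0r !add0r => ->.
Qed.

Lemma tcompZ x (c : chart R M n) a (v : tangent x) : (a *: v) c = a *: v c.
Proof. by rewrite -[a *: v]addr0 tcomp_linear tcomp0 addr0. Qed.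

Lemma tcomp_sum x (c : chart R M n) m (a : 'I_m -> R) (v : 'I_m -> tangent x) :
  (\sum_i a i *: v i) c = \sum_i a i *: v i c.
Proof.
elim: m a v => [|m IH] a v; first by rewrite !big_ord0 tcomp0.
by rewrite !big_ord_recl tcomp_linear IH.
Qed.

Lemma C1_field_near0 x : C1_field_near x (fun y : M => 0 : tangent y).
Proof.
have [c hc cx] := atlas_cover x; apply/(C1_field_nearP _ hc cx).
exists setT; first by split=> //; exact: openT.
rewrite (_ : field_in _ _ = fun=> 0); first exact: C1_on_cst.
by apply/funext => z; exact: tcomp0.
Qed.

Lemma C1_field_near_sum x m (a : 'I_m -> R) (F : 'I_m -> forall y : M, tangent y) :
  (forall i, C1_field_near x (F i)) ->
  C1_field_near x (fun y => \sum_i a i *: F i y).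
Proof.
elim: m a F => [|m IH] a F hF.
  by apply: near_C1_field (C1_field_near0 x); apply: nearW => y; rewrite big_ord0.
apply: near_C1_field (C1_field_near_comb (a ord0) (hF ord0)
  (IH (a \o lift ord0) (fun i => F (lift ord0 i)) (fun i => hF _))).
by apply: nearW => y; rewrite big_ord_recl.
Qed.

Variables (K : forall y : M, set (tangent y)).
Hypothesis hK : C1_subbundle r K.

Lemma subbundle_comb y a (v w : tangent y) : K v -> K w -> K (a *: v + w).
Proof.
have [U [F [Uy _ /(_ y Uy.2)[_ ->]]]] := hK y.
move=> [b _ <-] [b' _ <-]; exists (fun i => a * b i + b' i) => //.
rewrite scaler_sumr -big_split/=; apply: eq_bigr => i _.
by rewrite scalerDl scalerA.
Qed.

(** The extension has constant coefficients in a local frame. *)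
Lemma section_exists x (v : tangent x) : K v -> exists X, section_extending K v X.
Proof.
have [U [F [Ux hF hU]]] := hK x.
have [_ Kx] := hU x Ux.2; rewrite Kx => -[a _ av].
exists (fun y => \sum_i a i *: F i y); split=> //.
  by apply: C1_field_near_sum => i; exists U.
have : \forall y \near x, U y by exact: open_nbhs_nbhs.
by apply: filterS => y Uy; have [_ ->] := hU y Uy; exists a.
Qed.

Lemma section_extending_comb x a (v w : tangent x) X Y :
  section_extending K v X -> section_extending K w Y ->
  section_extending K (a *: v + w) (fun y => a *: X y + Y y).
Proof.
move=> [hX KX Xx] [hY KY Yx]; split; last by rewrite Xx Yx.
  exact: C1_field_near_comb.
by apply: filterS2 KX KY => y; exact: subbundle_comb.
Qed.

(** The difference of the sections vanishes at [x] and is a combination of a local frame nearby, so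
    [diff_frame_vanish] applies. The intended [l] is the transverse part in a slice chart at a point
    of [N], which kills [K x]. *)
Lemma diff_section_eq x (v : tangent x) X X' c m (l : {linear 'rV[R]_n -> 'rV[R]_m}) w :
  atlas c -> cdom c x -> (forall u, @K x u -> l (u c) = 0) ->
  section_extending K v X -> section_extending K v X' ->
  l ('d (field_in c X) (cmap c x) w) = l ('d (field_in c X') (cmap c x) w).
Proof.
move=> hc cx lK [hX KX Xx] [hX' KX' Xx'].
have [U [F [Ux hF hU]]] := hK x.
have dX := C1_field_diff hc cx hX; have dX' := C1_field_diff hc cx hX'.
have dD := is_diffB dX dX'.
have dF i : differentiable (field_in c (F i)) (cmap c x).
  have hFi : C1_field_near x (F i) by exists U.
  exact: (ex_diff (is_diff_def := C1_field_diff hc cx hFi)).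
have [indF Kx] := hU x Ux.2.
have E := congr1 (fun f : 'rV[R]_n -> 'rV[R]_n => l (f w)) (diff_val (is_diff_def := dD)).
suff H : l ('d (field_in c X - field_in c X') (cmap c x) w) = 0.
  exact: subr0_eq (etrans (esym (linearB l _ _)) (etrans (esym E) H)).
apply: (@diff_frame_vanish _ _ _ _ _ (fun i => field_in c (F i)) _ l _ w _ dF
  (ex_diff (is_diff_def := dD))).
- move=> b; rewrite (eq_bigr (fun i => b i *: F i x c)); last first.
    by move=> i _; rewrite field_in_cmap.
  rewrite -tcomp_sum => b0; apply: indF.
  by apply: (tangent_inj hc cx); rewrite b0 tcomp0.
- by rewrite !fctE !field_in_cmap// Xx Xx' subrr.
- have : \forall y \near x, exists b : 'I_r -> R, X y - X' y = \sum_i b i *: F i y.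
    have nU : \forall y \near x, U y by exact: open_nbhs_nbhs.
    apply: filterS3 nU KX KX' => y Uy KXy KXy'.
    have := subbundle_comb (-1) KXy' KXy; rewrite scaleN1r addrC.
    by have [_ ->] := hU y Uy => -[b _ bE]; exists b.
  move=> /(near_cinv cx); apply: filterS => z [b bE]; exists b.
  by rewrite !fctE /field_in -tcompB bE tcomp_sum.
- move=> i; rewrite field_in_cmap//; apply: lK; rewrite Kx.
  exists (fun j => (j == i)%:R) => //.
  by rewrite (bigD1 i)//= eqxx scale1r big1 ?addr0// => j /negPf->; rewrite scale0r.
Qed.

End Sections.

(** * The partial connection *)

Section BottConnection.
Context {R : realType} {p q r : nat} {M : C2manifold R (p + q)} {N : set M}.
Context {K : forall y : M, set (tangent y)}.
Hypotheses (hN : C2_submanifold N) (hK : C1_subbundle r K).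
Hypothesis KN : forall x, N x -> forall v, K v -> v \in tangentN_pred N x.
Implicit Types (x y : M) (X Y : forall y : M, tangent y).
Implicit Types (c : chart R M (p + q)) (eta : forall y, normal N y).

(** Along [N] the section lies in [K], hence in the tangent space of [N]: its transverse part
    vanishes on the slice, and [diff_flat] applies. *)
Lemma rsubmx_diff_section x (v : tangent x) X c u : slice_chart N c -> cdom c x ->
  N x -> section_extending K v X -> rsubmx u = 0 ->
  rsubmx ('d (field_in c X) (cmap c x) u) = 0.
Proof.
move=> hc cx Nx [hX KX _] u0.
have dl := is_diff_linear (rsubmx : {linear 'rV[R]_(p + q) -> 'rV[R]_q})
  (C1_field_diff hc.1 cx hX).
have E := congr1 (fun f : 'rV[R]_(p + q) -> 'rV[R]_q => f u) (diff_val (is_diff_def := dl)).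
apply: etrans (esym E) _.
apply: (diff_flat (ex_diff (is_diff_def := dl)) (slice_rsubmx hc cx Nx) _ u0).
apply: (near_slice (P := fun y => rsubmx (X y c) = 0) hc cx).
apply: filterS2 (near_cdom cx) KX => y cy Ky Ny; apply/eqP.
by rewrite -(tangentNE _ hc cy Ny); exact: KN.
Qed.

(** Two liftings have the same class along [N], so the transverse part of their difference vanishes
    on the slice. *)
Lemma rsubmx_diff_lifting x eta Y Y' c u : slice_chart N c -> cdom c x ->
  N x -> lifting_near x eta Y -> lifting_near x eta Y' -> rsubmx u = 0 ->
  rsubmx ('d (field_in c Y) (cmap c x) u) = rsubmx ('d (field_in c Y') (cmap c x) u).
Proof.
move=> hc cx Nx [hY Yeta] [hY' Y'eta] u0.
have dD := is_diffB (C1_field_diff hc.1 cx hY) (C1_field_diff hc.1 cx hY').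
have dl := is_diff_linear (rsubmx : {linear 'rV[R]_(p + q) -> 'rV[R]_q}) dD.
have E := congr1 (fun f : 'rV[R]_(p + q) -> 'rV[R]_q => f u) (diff_val (is_diff_def := dl)).
apply: subr0_eq; apply: etrans (esym (linearB rsubmx _ _)) (etrans (esym E) _).
apply: (diff_flat (ex_diff (is_diff_def := dl)) (slice_rsubmx hc cx Nx) _ u0).
apply: (near_slice (P := fun y => rsubmx (Y y c - Y' y c) = 0) hc cx).
apply: filterS3 (near_cdom cx) Yeta Y'eta => y cy Ye Y'e Ny.
rewrite linearB; apply/eqP; rewrite subr_eq0; apply/eqP.
by apply/(normal_class_eq _ _ hc cy Ny); rewrite Ye// Y'e.
Qed.

(** Three exchanges, all modulo tangent vectors of [N]: [Y] for [Y'] in the derivative along [v]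
    ([e1]), the direction [Y x] for [Y' x] in the derivative of [X] ([e2]), and [X] for [X'] in the
    derivative along [Y' x] ([e3]). *)
Lemma rsubmx_bracket x (v : tangent x) eta X X' Y Y' c :
  slice_chart N c -> cdom c x -> N x -> K v ->
  section_extending K v X -> section_extending K v X' ->
  lifting_near x eta Y -> lifting_near x eta Y' ->
  rsubmx (bracket_in c X Y x) = rsubmx (bracket_in c X' Y' x).
Proof.
move=> hc cx Nx Kv hX hX' hY hY'.
have tK (u : tangent x) : K u -> rsubmx (u c) = 0.
  by move=> Ku; apply/eqP; rewrite -(tangentNE _ hc cx Nx); exact: KN.
have [[_ _ Xx] [_ _ X'x]] := (hX, hX').
have YY' : rsubmx (Y x c - Y' x c) = 0.
  have [[_ /nbhs_singleton/(_ Nx) e] [_ /nbhs_singleton/(_ Nx) e']] := (hY, hY').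
  by rewrite linearB/= ((normal_class_eq (Y x) (Y' x) hc cx Nx).1 _) ?subrr// e e'.
have e1 := rsubmx_diff_lifting hc cx Nx hY hY' (tK _ Kv).
have e2 := rsubmx_diff_section hc cx Nx hX YY'.
have e3 := diff_section_eq (l := rsubmx) hK (Y' x c) hc.1 cx tK hX hX'.
rewrite linearB in e2.
have {e2} e2 : rsubmx ('d (field_in c X) (cmap c x) (Y x c)) =
    rsubmx ('d (field_in c X) (cmap c x) (Y' x c)).
  by apply: subr0_eq; exact: etrans (esym (linearB rsubmx _ _)) e2.
rewrite /bracket_in Xx X'x.
have key (a b a' b' : 'rV[R]_(p + q)) : rsubmx a = rsubmx a' ->
    rsubmx b = rsubmx b' -> rsubmx (a - b) = rsubmx (a' - b').
  by move=> aa bb; rewrite !linearB/= aa bb.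
exact: key e1 (etrans e2 e3).
Qed.

(** Picks some class produced by the formula; [bottE] shows that it is the only one. The default [0]
    is taken only when no section, lifting and bracket fit together. *)
Definition bott x (v : tangent x) eta : normal N x :=
  xget (0 : normal N x) [set e | exists X Y Z,
    [/\ section_extending K v X, lifting_near x eta Y,
        is_lie_bracket X Y Z & normal_class N Z = e]].

Lemma bottE x (v : tangent x) eta X Y Z : N x -> K v ->
  section_extending K v X -> lifting_near x eta Y -> is_lie_bracket X Y Z ->
  bott v eta = normal_class N Z.
Proof.
move=> Nx Kv hX hY hZ; have [c hc cx] := hN Nx.
rewrite /bott; case: xgetP => [_ -> [X' [Y' [Z' [hX' hY' hZ' <-]]]]|/(_ (normal_class N Z))].
  apply/(normal_class_eq _ _ hc cx Nx).
  rewrite (hZ c hc.1 cx) (hZ' c hc.1 cx).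
  exact: rsubmx_bracket hc cx Nx Kv hX' hX hY' hY.
by case; exists X, Y, Z.
Qed.

Lemma bottP x (v : tangent x) eta X Y : N x -> K v ->
  section_extending K v X -> lifting_near x eta Y ->
  exists2 Z, is_lie_bracket X Y Z & bott v eta = normal_class N Z.
Proof.
move=> Nx Kv hX hY; have [Z hZ] := lie_bracket_exists (let: And3 h _ _ := hX in h) hY.1.
by exists Z => //; exact: bottE hX hY hZ.
Qed.

Lemma diff_field_comb c a x X Y u : atlas c -> cdom c x ->
  C1_field_near x X -> C1_field_near x Y ->
  'd (field_in c (fun y => a *: X y + Y y)) (cmap c x) u =
  a *: 'd (field_in c X) (cmap c x) u + 'd (field_in c Y) (cmap c x) u.
Proof.
move=> hc cx hX hY.
have dXY := is_diff_fext (fun z => esym (tcomp_linear c a (X (cinv c z)) (Y (cinv c z))))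
  (frefl _) (is_diffD (is_diffZ a (C1_field_diff hc cx hX)) (C1_field_diff hc cx hY)).
exact: (congr1 (fun f : 'rV[R]_(p + q) -> 'rV[R]_(p + q) => f u)
  (diff_val (is_diff_def := dXY))).
Qed.

Let subr_comb (a : R) (b b' d d' : 'rV[R]_(p + q)) :
  (a *: b + b') - (a *: d + d') = a *: (b - d) + (b' - d').
Proof. by rewrite scalerBr opprD addrACA. Qed.

Lemma bracket_in_combl c a x X X' Y : atlas c -> cdom c x ->
  C1_field_near x X -> C1_field_near x X' ->
  bracket_in c (fun y => a *: X y + X' y) Y x =
  a *: bracket_in c X Y x + bracket_in c X' Y x.
Proof.
move=> hc cx hX hX'.
have e1 := etrans (congr1 ('d (field_in c Y) (cmap c x)) (tcomp_linear c a (X x) (X' x)))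
  (linearP ('d (field_in c Y) (cmap c x)) a (X x c) (X' x c)).
have e2 := diff_field_comb a (Y x c) hc cx hX hX'.
exact: etrans (congr2 (fun s t => s - t) e1 e2) (subr_comb _ _ _ _ _).
Qed.

Lemma bracket_in_combr c a x X Y Y' : atlas c -> cdom c x ->
  C1_field_near x Y -> C1_field_near x Y' ->
  bracket_in c X (fun y => a *: Y y + Y' y) x =
  a *: bracket_in c X Y x + bracket_in c X Y' x.
Proof.
move=> hc cx hY hY'.
have e1 := diff_field_comb a (X x c) hc cx hY hY'.
have e2 := etrans (congr1 ('d (field_in c X) (cmap c x)) (tcomp_linear c a (Y x) (Y' x)))
  (linearP ('d (field_in c X) (cmap c x)) a (Y x c) (Y' x c)).
exact: etrans (congr2 (fun s t => s - t) e1 e2) (subr_comb _ _ _ _ _).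
Qed.

(** A lifting of [eta] near [x] is also one of [eta']. *)
Lemma bott_local x (v : tangent x) eta eta' : N x -> K v ->
  C1_normal_near x eta -> C1_normal_near x eta' ->
  (\forall y \near x, N y -> eta y = eta' y) -> bott v eta = bott v eta'.
Proof.
move=> Nx Kv heta heta' E; have [X hX] := section_exists hK Kv.
have [Y hY] := lifting_exists hN Nx heta.
have [Z hZ ->] := bottP Nx Kv hX hY; apply/esym/(bottE Nx Kv hX _ hZ).
split; first exact: hY.1.
by apply: filterS2 hY.2 E => y e e' Ny; rewrite e// e'.
Qed.

(** One lifting serves all three terms. As the direction is a vector at [x], linearity over the
    reals contains the rule for multiplying [X] by a function. *)
Lemma bott_linear_dir x a (v w : tangent x) eta : N x -> K v -> K w ->
  C1_normal_near x eta -> bott (a *: v + w) eta = a *: bott v eta + bott w eta.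
Proof.
move=> Nx Kv Kw heta; have [Y hY] := lifting_exists hN Nx heta.
have [X hX] := section_exists hK Kv; have [X' hX'] := section_exists hK Kw.
have hXX' := section_extending_comb hK a hX hX'.
have [Z hZ ->] := bottP Nx Kv hX hY; have [Z' hZ' ->] := bottP Nx Kw hX' hY.
have [Z'' hZ'' ->] := bottP Nx (subbundle_comb hK a Kv Kw) hXX' hY.
apply: etrans _ (@normal_class_linear _ _ _ _ N x a Z Z'); congr (normal_class N _).
have [c hc cx] := hN Nx; apply: (tangent_inj hc.1 cx).
have [[h _ _] [h' _ _]] := (hX, hX').
rewrite tcomp_linear (hZ c hc.1 cx) (hZ' c hc.1 cx) (hZ'' c hc.1 cx).
exact: bracket_in_combl hc.1 cx h h'.
Qed.

Lemma bott_linear_section x (v : tangent x) a eta eta' : N x -> K v ->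
  C1_normal_near x eta -> C1_normal_near x eta' ->
  bott v (fun y => a *: eta y + eta' y) = a *: bott v eta + bott v eta'.
Proof.
move=> Nx Kv heta heta'; have [Y hY] := lifting_exists hN Nx heta.
have [Y' hY'] := lifting_exists hN Nx heta'; have [X hX] := section_exists hK Kv.
have hYY' : lifting_near x (fun y => a *: eta y + eta' y) (fun y => a *: Y y + Y' y).
  split; first exact: C1_field_near_comb hY.1 hY'.1.
  apply: filterS2 hY.2 hY'.2 => y e e' Ny.
  by rewrite (@normal_class_linear _ _ _ _ N y a (Y y) (Y' y)) e// e'.
have [Z hZ ->] := bottP Nx Kv hX hY; have [Z' hZ' ->] := bottP Nx Kv hX hY'.
have [Z'' hZ'' ->] := bottP Nx Kv hX hYY'.
apply: etrans _ (@normal_class_linear _ _ _ _ N x a Z Z'); congr (normal_class N _).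
have [c hc cx] := hN Nx; apply: (tangent_inj hc.1 cx).
rewrite tcomp_linear (hZ c hc.1 cx) (hZ' c hc.1 cx) (hZ'' c hc.1 cx).
exact: bracket_in_combr hc.1 cx hY.1 hY'.1.
Qed.

(** For a function [k] extending [phi] off [N], the field [k Y] lifts [phi eta], and the rule is the
    class of [[X, k Y] = k [X, Y] + (X k) Y] at [x]. *)
Lemma bott_leibniz x (v : tangent x) (phi : M -> R) eta : N x -> K v ->
  C1_fun_near N x phi -> C1_normal_near x eta ->
  forall c, slice_chart N c -> cdom c x ->
  bott v (fun y => phi y *: eta y) =
  phi x *: bott v eta + dir_derivative c v phi *: eta x.
Proof.
move=> Nx Kv [U Ux hphi] heta c hc cx.
have [Y hY] := lifting_exists hN Nx heta; have [X hX] := section_exists hK Kv.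
(* The extension of [phi], constant in the transverse coordinates of [c]. *)
pose k (z : 'rV[R]_(p + q)) : R^o := phi (slice_pt c (lsubmx z)).
have kx y : cdom c y -> N y -> k (cmap c y) = phi y.
  by move=> cy Ny; rewrite /k (slice_pt_lsubmx hc cy Ny).
have Ax := open_nbhs_slice_nbhs hc cx Nx Ux.
have hk : C1_on (slice_nbhs c U) k := C1_slice_extension Ax.1 (hphi c hc).
have hkY : lifting_near x (fun y => phi y *: eta y) (fun y => k (cmap c y) *: Y y).
  split.
    apply: near_C1_field (C1_field_near_scale_add hc.1 cx Ax hk hY.1 (C1_field_near0 x)).
    by apply: nearW => y; rewrite addr0.
  apply: filterS2 (near_cdom cx) hY.2 => y cy e Ny; rewrite kx// -e//.
  exact: linearZ_LR.
have [Z hZ ->] := bottP Nx Kv hX hY; have [Z' hZ' ->] := bottP Nx Kv hX hkY.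
have -> : eta x = normal_class N (Y x) by rewrite (nbhs_singleton hY.2).
suff -> : Z' = phi x *: Z + dir_derivative c v phi *: Y x.
  apply: etrans (@normal_class_linear _ _ _ _ N x _ _ _) _; congr (_ + _).
  exact: linearZ_LR.
apply: (tangent_inj hc.1 cx); rewrite tcomp_linear tcompZ (hZ c hc.1 cx) (hZ' c hc.1 cx).
have [_ _ Xx] := hX.
have dphi := C1_on_is_diff (hphi c hc) Ax.2.2.
have dlsub := is_diff_linear (lsubmx : {linear 'rV[R]_(p + q) -> 'rV[R]_p})
  (is_diff_id (cmap c x)).
(* As [k] factors through [lsubmx], the chain rule turns its derivative along [X x] into
   [dir_derivative c v phi]. *)
have ek := congr1 (fun f : 'rV[R]_(p + q) -> R^o => f (X x c))
  (diff_val (is_diff_def := is_diff_comp dlsub dphi)).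
have dkY := is_diff_scale (C1_on_is_diff hk Ax.2) (C1_field_diff hc.1 cx hY.1).
have nE : {near cmap c x, (fun z => k z *: field_in c Y z) =1
    field_in c (fun y => k (cmap c y) *: Y y)}.
  have : nbhs (cmap c x) (slice_nbhs c U) by exact: open_nbhs_nbhs.
  by apply: filterS => _ [[y cy <-] _]; rewrite /field_in cmapK// tcompZ.
have e1 := congr1 (fun f : 'rV[R]_(p + q) -> 'rV[R]_(p + q) => f (X x c))
  (etrans (near_diff nE (ex_diff (is_diff_def := dkY))) (diff_val (is_diff_def := dkY))).
have e2 := etrans (congr1 ('d (field_in c X) (cmap c x)) (tcompZ c (k (cmap c x)) (Y x)))
  (linearZ_LR ('d (field_in c X) (cmap c x)) (k (cmap c x)) (Y x c)).
apply: etrans (congr2 (fun s t => s - t) e1 e2) _.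
rewrite field_in_cmap// -Xx -(kx x cx Nx) scalerBr addrAC; congr (_ - _ + _ *: _).
exact: ek.
Qed.

Lemma bott_partial_connection : partial_connection K (@bott).
Proof.
split.
- exact: bott_local.
- by move=> x a v w eta; exact: bott_linear_dir.
- by move=> x v a eta eta'; exact: bott_linear_section.
- exact: bott_leibniz.
Qed.

End BottConnection.

Theorem proposition1p1 (R : realType) (p q r : nat)
    (M : C2manifold R (p + q)) (N : set M)
    (K : forall y : M, set (tangent y)) :
  C2_submanifold N ->
  C1_subbundle r K ->
  (forall x, N x -> forall v, K x v -> v \in tangentN_pred N x) ->
  exists nabla : forall x : M,
      tangent x -> (forall y, normal N y) -> normal N x,
    partial_connection K nabla /\
    (forall (x : M) (v : tangent x) (eta : forall y, normal N y),
       N x -> K x v -> C1_normal_near x eta ->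
       [/\ exists Xt, section_extending K v Xt,
           exists Yt, lifting_near x eta Yt &
           forall Xt Yt, section_extending K v Xt -> lifting_near x eta Yt ->
             exists2 Z, is_lie_bracket Xt Yt Z &
               nabla x v eta = normal_class N Z]).
Proof.
move=> hN hK KN; exists (fun x v eta => @bott _ _ _ _ _ K x v eta); split.
  exact: bott_partial_connection hN hK KN.
move=> x v eta Nx Kv heta.
have eX := section_exists hK Kv; have eY := lifting_exists hN Nx heta.
split; [exact: eX | exact: eY | move=> X Y hX hY].
have eZ := bottP hN hK KN Nx Kv hX hY; exact: eZ.
Qed.
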